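(* Let $d$ be a positive integer and $x\in\mathbb R$. Suppose the real-valued function $f$ has $2d$ derivatives at $x$ and $Df(x)>0$. Then the following are equivalent: (i) for every $1\le k\le d-1$, $S_k(f)(x)$ exists and $S_k(f)(x)>0$; (ii) the $d$'th Padé approximant to $f$ at $x$ exists, has degree exactly $d$, and is in the Pick class.
   Context: $D$ denotes differentiation; $f$ is defined on a real neighbourhood of $x$. Padé approximants and Schwarzian derivatives: a rational map is a quotient $p/q$ of polynomials with $q \not\equiv 0$; its degree is $\max(\deg p,\deg q)$ when $p,q$ are relatively prime. Let $k \ge 0$ be an integer and $g$ a real-valued function which is $2k$ times differentiable at a real point $y$. The $k$'th Padé approximant to $g$ at $y$, denoted $[g]_y^k$, is the rational map $\mathcal R$ of degree at most $k$ (finite at $y$) with $D^j\mathcal R(y) = D^j g(y)$ for $0 \le j \le 2k$, if such a map exists (it is then unique, and has real coefficients). If moreover $g$ is $2k+1$ times differentiable at $y$, $Dg(y) \ne 0$, $k\ge 1$, and $\mathcal R = [g]_y^k$ exists, the Schwarzian derivative of order $k$ is $S_k(g)(y) = D^{2k+1}(\mathcal R^{-1}\circ g)(y)$, where $\mathcal R^{-1}$ is the local inverse of $\mathcal R$ sending $g(y)$ to $y$; equivalently $S_k(g)(y) = D^{2k+1}(g-\mathcal R)(y)/Dg(y)$. We say $S_k(g)(y)$ exists when $[g]_y^k$ exists. Pick class: let $\mathbb H=\{z\in\mathbb C:\operatorname{Im} z>0\}$ and $\overline{\mathbb H}=\{z\in\mathbb C:\operatorname{Im} z\ge 0\}\cup\{\infty\}$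 its closure in the Riemann sphere. The Pick class consists of all holomorphic functions $\mathbb H\to\overline{\mathbb H}$. *)

(* Defs.v *)
From HB Require Import structures.
From mathcomp Require Import all_boot all_order all_algebra.
From mathcomp Require Import complex.
From mathcomp Require Import all_classical all_reals all_analysis.

Set Implicit Arguments.
Unset Strict Implicit.
Unset Printing Implicit Defensive.

Import Order.TTheory GRing.Theory Num.Theory.
Import numFieldNormedType.Exports.

Local Open Scope ring_scope.
Local Open Scope classical_set_scope.

(* [n.+1] derivatives at [x]: [n] derivatives at every point of a neighbourhood
   of [x], and the [n]-th one differentiable at [x].  Only the germ of [f] at
   [x] matters, so a function defined near [x] is given as a total one. *)
Fixpoint ndiff (R : realType) (n : nat) (f : R -> R) (x : R) : Prop :=
  if n is m.+1 then
    (\forall y \near x, ndiff m f y) /\ derivable (f^`(m)) x 1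
  else True.

(* A rational map with real coefficients, in lowest terms. *)
Record ratmap (R : realType) := RatMap {
  rm_num : {poly R};
  rm_den : {poly R};
  rm_den_neq0 : rm_den != 0;
  rm_coprime : coprimep rm_num rm_den
}.

Definition rm_degree (R : realType) (r : ratmap R) : nat :=
  maxn (size (rm_num r)).-1 (size (rm_den r)).-1.

(* Meaningful only off the real poles; in the Pade conditions [y] is not one. *)
Definition rm_real (R : realType) (r : ratmap R) (t : R) : R :=
  (rm_num r).[t] / (rm_den r).[t].

Definition is_pade (R : realType) (k : nat) (g : R -> R) (y : R)
    (r : ratmap R) : Prop :=
  [/\ ndiff (2 * k) g y, (rm_degree r <= k)%N, (rm_den r).[y] != 0
    & forall j, (j <= 2 * k)%N -> (rm_real r)^`(j) y = g^`(j) y].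

Definition is_local_inverse (R : realType) (phi : R -> R) (y : R)
    (psi : R -> R) : Prop :=
  (\forall t \near y, psi (phi t) = t) /\
  (\forall w \near phi y, phi (psi w) = w).

(* [s] is the Schwarzian derivative of order [k] of [g] at [y].  For a Pade
   approximant, [rm_real r y = g y], so the local inverse sends [g y] to [y];
   as its germ is unique, [s] is unique. *)
Definition is_schwarzian (R : realType) (k : nat) (g : R -> R) (y s : R) : Prop :=
  [/\ (1 <= k)%N, ndiff (2 * k).+1 g y, g^`() y != 0
    & exists (r : ratmap R) (psi : R -> R),
        [/\ is_pade k g y r, is_local_inverse (rm_real r) y psi
          & s = (psi \o g)^`((2 * k).+1) y]].

(* The Riemann sphere: [None] is the point at infinity. *)
Definition sphere (R : realType) : Type := one_point_compactification R[i]^o.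

Definition sphere_inv (R : realType) (w : sphere R) : sphere R :=
  if w is Some u then (if u == 0 then None else Some (u^-1 : R[i])) else Some 0.

(* The chart [w] of the sphere minus infinity (with a junk value there); the
   chart [1/w] of the sphere minus 0 is its composite with [sphere_inv]. *)
Definition sphere_coord (R : realType) (w : sphere R) : R[i]^o :=
  if w is Some u then u else 0.

Definition sphere_holomorphic_at (R : realType) (F : R[i]^o -> sphere R)
    (z : R[i]^o) : Prop :=
  ((\forall u \near z, F u <> None) /\
     derivable (fun u => sphere_coord (F u)) z 1) \/
  ((\forall u \near z, F u <> Some 0) /\
     derivable (fun u => sphere_coord (sphere_inv (F u))) z 1).

Definition upper_half_plane (R : realType) : set R[i]^o :=
  [set z | 0 < complex.Im z].

Definition closed_upper_half_plane (R : realType) : set (sphere R) :=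
  [set w | if w is Some u then 0 <= complex.Im u else True].

(* Only the values of [F] on the (open) upper half-plane are constrained. *)
Definition pick_class (R : realType) (F : R[i]^o -> sphere R) : Prop :=
  forall z, upper_half_plane z ->
    sphere_holomorphic_at F z /\ closed_upper_half_plane (F z).

(* By coprimality a zero of the denominator is a genuine pole. *)
Definition rm_complex (R : realType) (r : ratmap R) (z : R[i]^o) : sphere R :=
  let p := map_poly (real_complex R) (rm_num r) in
  let q := map_poly (real_complex R) (rm_den r) in
  if q.[z] == 0 then None else Some (p.[z] / q.[z]).

(* Main.v *)
(* Let [T] be the Taylor expansion of [f] at [x] and [mom T] the linear functional
   [X ^ n |-> T_(n+1)] on polynomials.  Both conditions say that the Hankel form
   [(u, v) |-> mom T (u v)] is positive definite on polynomials of degree [< d].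
   If [P / Q] is the Pade approximant of order [k] (recentred at 0), the reversed
   denominator [v = X ^ k Q(1 / X)] is orthogonal to the polynomials of degree
   [< k], and [mom T (v ^ 2)] is a positive multiple of [S_k (f)]; so the form
   stays positive definite from degree [< k] to degree [<= k] exactly when
   [S_k (f) > 0].  For the Pick class, the Christoffel-Darboux identity writes
   [Im (v(w) conj (p(w)))], with [p] the reversed numerator, as [Im w] times the
   value of the Hermitian form at a polynomial.  Conversely, in the Pick class all
   the roots of [v] are real and simple, because [c h ^ m] has to stay in the upper
   half-plane along with [h], and Gauss quadrature at these roots expresses
   [mom T (u ^ 2)] with positive weights. *)
Require Import Defs.
From HB Require Import structures.
From mathcomp Require Import all_boot all_order all_algebra.
From mathcomp Require Import complex polyrcf.
From mathcomp Require Import all_classical all_reals all_analysis.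
From mathcomp Require Import ring lra zify.

Set Implicit Arguments.
Unset Strict Implicit.
Unset Printing Implicit Defensive.

Import Order.TTheory GRing.Theory Num.Theory.
Import numFieldNormedType.Exports.

Local Open Scope ring_scope.
Local Open Scope classical_set_scope.

(** * The moment functional and reversed polynomials *)

Section Moment.
Variable K : comNzRingType.
Implicit Types (T P Q p u : {poly K}) (k n : nat).

Lemma coef_ge_size p k n : (size p <= k)%N -> (k <= n)%N -> p`_n = 0.
Proof. by move=> h1 h2; rewrite nth_default // (leq_trans h1). Qed.

(* The linear functional [X ^ n |-> T_(n+1)]; its Gram matrix in the monomials is
   the Hankel matrix of [T]. *)
Definition mom T p : K := \sum_(i < size p) p`_i * T`_i.+1.

Lemma sum_coef_widen (A : nat -> K) n p : (size p <= n)%N ->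
  \sum_(i < size p) p`_i * A i = \sum_(i < n) p`_i * A i.
Proof.
move=> hp; rewrite (big_ord_widen n (fun i => p`_i * A i) hp).
rewrite big_mkcond; apply: eq_bigr => i _; case: ltnP => // h.
by rewrite nth_default ?mul0r.
Qed.

Lemma mom_widen T n p : (size p <= n)%N -> mom T p = \sum_(i < n) p`_i * T`_i.+1.
Proof. exact: (sum_coef_widen (fun i => T`_i.+1)). Qed.

Lemma mom_is_linear T : linear_for *%R (mom T).
Proof.
move=> c p q; set n := maxn (size p) (size q).
have hp : (size p <= n)%N by rewrite leq_maxl.
have hq : (size q <= n)%N by rewrite leq_maxr.
have hs : (size (c *: p + q)%R <= n)%N.
  rewrite (leq_trans (size_polyD _ _)) // geq_max hq andbT.
  by rewrite (leq_trans (size_scale_leq _ _)).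
rewrite (mom_widen T hs) (mom_widen T hp) (mom_widen T hq).
rewrite mulr_sumr -big_split /=; apply: eq_bigr => i _.
by rewrite coefD coefZ mulrDl mulrA.
Qed.

HB.instance Definition _ T :=
  GRing.isLinear.Build K {poly K} K *%R (mom T) (mom_is_linear T).

Lemma mom_Xn T n : mom T 'X^n = T`_n.+1.
Proof.
rewrite (mom_widen T (n := n.+1)) ?size_polyXn // big_ord_recr /= big1 ?add0r.
  by rewrite coefXn eqxx mul1r.
by move=> i _ /=; rewrite coefXn ltn_eqF ?mul0r.
Qed.

(** The reversal is taken at the nominal degree [k]: a drop of the degree of [Q] becomes a root at
    0, and coefficients of index above [k] are cut off, as in [rev_poly k (T * Q)]. *)
Definition rev_poly k Q := \poly_(i < k.+1) Q`_(k - i).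

Lemma size_rev_poly k Q : (size (rev_poly k Q) <= k.+1)%N.
Proof. exact: size_poly. Qed.

Lemma coef_rev_poly k Q i : (i <= k)%N -> (rev_poly k Q)`_i = Q`_(k - i).
Proof. by move=> h; rewrite coef_poly ltnS h. Qed.

Lemma size_rev_poly_eq k Q : Q`_0 != 0 -> size (rev_poly k Q) = k.+1.
Proof.
move=> Q0; apply/eqP; rewrite eqn_leq size_rev_poly ltnNge.
by apply: contra Q0 => /leq_sizeP/(_ k (leqnn _)); rewrite coef_rev_poly // subnn => ->.
Qed.

(** Pairing with a reversal is a convolution, since the indices of [T] and [Q] add up to
    [i + k + 1]; the absent term in [T_0] carries the factor [Q_(i + k + 1) = 0]. *)
Lemma mom_Xn_rev T k Q i : (size Q <= k.+1)%N ->
  mom T ('X^i * rev_poly k Q) = (T * Q)`_(i + k).+1.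
Proof.
move=> hQ; have hs : (size ('X^i * rev_poly k Q)%R <= (i + k).+1)%N.
  apply: leq_trans (size_polyMleq _ _) _; rewrite size_polyXn.
  by rewrite addSn /= -addnS leq_add2l size_rev_poly.
rewrite (mom_widen T hs) coefM [in RHS]big_ord_recl /= subn0.
rewrite (nth_default _ (leq_trans hQ _)) ?mulr0 ?add0r; last by lia.
apply: eq_bigr => j _; rewrite /bump /= coefXnM add1n subSS [RHS]mulrC.
case: (ltnP j i) => h; first by rewrite mul0r nth_default ?mul0r //; apply: leq_trans hQ _; lia.
rewrite coef_rev_poly; last by have := ltn_ord j; lia.
by congr (Q`__ * _); have := ltn_ord j; lia.
Qed.

Lemma mom_rev T k Q u : (size Q <= k.+1)%N -> 
  mom T (u * rev_poly k Q) = \sum_(i < size u) u`_i * (T * Q)`_(i + k).+1.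
Proof.
move=> hQ; rewrite -{1}[u]coefK poly_def mulr_suml linear_sum /=.
by apply: eq_bigr => i _; rewrite -scalerAl linearZ /= mom_Xn_rev.
Qed.

Lemma mom_rev_eq0 T k m Q u : (size Q <= k.+1)%N ->
  (forall n, (k < n <= k + m)%N -> (T * Q)`_n = 0) ->
  (size u <= m)%N -> mom T (u * rev_poly k Q) = 0.
Proof.
move=> hQ h0 hu; rewrite mom_rev // big1 // => i _.
by rewrite h0 ?mulr0 //; have := ltn_ord i; lia.
Qed.

(* [pade_poly T k P Q]: [P / Q] is the Pade approximant of order [k] at 0 of
   the jet [T], up to common factors. *)
Definition pade_poly T k P Q : Prop :=
  [/\ (size P <= k.+1)%N, (size Q <= k.+1)%N, Q`_0 != 0
    & forall n, (n <= 2 * k)%N -> (T * Q)`_n = P`_n].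

Lemma pade_poly_coef0 T k P Q : pade_poly T k P Q ->
  forall n, (k < n <= k + k)%N -> (T * Q)`_n = 0.
Proof. by case=> hP _ _ h n hn; rewrite h ?(coef_ge_size hP) //; lia. Qed.

Lemma rev_poly_pade T k P Q : pade_poly T k P Q -> rev_poly k (T * Q) = rev_poly k P.
Proof.
case=> _ _ _ hT; apply/polyP => i; rewrite [LHS]coef_poly [RHS]coef_poly.
case: ltnP => // _; rewrite hT //.
by rewrite (leq_trans (leq_subr i k)) // mul2n -addnn leq_addr.
Qed.

End Moment.

(** * Positive definiteness of the Hankel form and existence of Pade pairs *)

Section PosDef.
Variable K : realFieldType.
Implicit Types (T P Q p u : {poly K}) (k n : nat).

Definition mom_posdef T k : Prop :=
  forall u, u != 0 -> (size u <= k)%N -> 0 < mom T (u ^+ 2).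

(** The reversal [v] of [Q] has degree exactly [k] because [Q_0 != 0], so a polynomial of degree at
    most [k] is [w + c v] with [w] of degree [< k], hence orthogonal to [v]. What is left is the
    sign of [mom T (v ^ 2)], which is [Q_0] times the leading error of the pair. *)
Lemma mom_posdefS T k P Q : pade_poly T k P Q -> mom_posdef T k ->
  mom_posdef T k.+1 <-> 0 < Q`_0 * (T * Q - P)`_(2 * k).+1.
Proof.
move=> pd hk; have h0 := pade_poly_coef0 pd; case: pd => hP hQ Q0 hT.
have vk : (rev_poly k Q)`_k = Q`_0 by rewrite coef_rev_poly // subnn.
set v := rev_poly k Q in vk *.
have sv : size v = k.+1 := size_rev_poly_eq k Q0.
have eE : (T * Q - P)`_(2 * k).+1 = (T * Q)`_(2 * k).+1.
  by rewrite coefB (coef_ge_size hP) ?subr0 //; lia.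
have vv : mom T (v ^+ 2) = Q`_0 * (T * Q - P)`_(2 * k).+1.
  rewrite eE expr2 mom_rev // sv big_ord_recr /= big1 ?add0r.
    by rewrite vk addnn -mul2n.
  by move=> i _ /=; rewrite h0 ?mulr0 //; have := ltn_ord i; lia.
split=> [h|h u u0 su].
  by rewrite -vv h ?sv // -size_poly_gt0 sv.
pose c := u`_k / v`_k; pose w := u - c *: v.
have sw : (size w <= k)%N.
  apply/leq_sizeP => j; rewrite leq_eqVlt => /predU1P[<-|hj].
    by rewrite coefB coefZ /c mulfVK ?subrr // vk.
  rewrite coefB coefZ (nth_default _ (leq_trans su _)) ?(nth_default _ (leq_trans _ hj)) ?sv //.
  by rewrite mulr0 subrr.
have uE : u = w + c *: v by rewrite /w subrK.
have -> : mom T (u ^+ 2) = mom T (w ^+ 2) + c ^+ 2 * mom T (v ^+ 2).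
  have -> : u ^+ 2 = w ^+ 2 + c *: (w * v) + c *: (w * v) + (c * c) *: (v ^+ 2).
    rewrite uE -!mul_polyC polyCM; ring.
  by rewrite !linearD !linearZ /= (mom_rev_eq0 (m := k)) // mulr0 !addr0.
have [w0|w0] := eqVneq w 0.
  rewrite w0 expr0n linear0 add0r mulr_gt0 ?vv // exprn_even_gt0 //=.
  by apply: contraNneq u0 => c0; rewrite uE w0 c0 scale0r addr0.
by rewrite ltr_wpDr ?hk // mulr_ge0 ?sqr_ge0 // vv ltW.
Qed.

Lemma mom_posdef1 T : mom_posdef T 1 <-> 0 < T`_1.
Proof.
have E c : mom T (c%:P ^+ 2) = c ^+ 2 * T`_1.
  by rewrite -polyC_exp (mom_widen T (n := 1)) ?size_polyC ?leq_b1 // big_ord1 coefC.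
split=> [h|h u u0 su].
  by have := h 1%:P; rewrite E expr1n mul1r polyC_eq0 oner_eq0 size_polyC leq_b1; apply.
rewrite (size1_polyC su) E mulr_gt0 // exprn_even_gt0 //=.
by apply: contraNneq u0 => u00; rewrite (size1_polyC su) u00.
Qed.

Lemma mom_posdefW T k m : (k <= m)%N -> mom_posdef T m -> mom_posdef T k.
Proof. by move=> h hm u u0 su; apply: hm => //; apply: leq_trans h. Qed.

(* A smaller pair would make its reversed denominator isotropic. *)
Lemma pade_poly_minimal T k P Q : mom_posdef T k.+1 ->
  (size P <= k.+1)%N -> (size Q <= k.+1)%N -> 
  (forall n, (n <= 2 * k.+1)%N -> (T * Q)`_n = P`_n) -> Q = 0.
Proof.
move=> pd sP sQ hT; apply/eqP; apply: contraT => Q0.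
have : 0 < mom T (rev_poly k Q ^+ 2).
  apply: pd; last exact: size_rev_poly.
  apply: contraNneq Q0 => r0; apply/eqP/polyP => i; rewrite coef0.
  case: (leqP i k) => hi; last by rewrite nth_default ?(leq_trans sQ).
  have := coef_rev_poly Q (leq_subr i k).
  by rewrite r0 coef0 subKn // => <-.
rewrite expr2 (mom_rev_eq0 (m := k.+1)) ?ltxx ?size_rev_poly // => n hn.
by rewrite hT ?(coef_ge_size sP) //; lia.
Qed.

Lemma rev_polyK (F : comNzRingType) k (Q : {poly F}) : (size Q <= k.+1)%N ->
  rev_poly k (rev_poly k Q) = Q.
Proof.
move=> sQ; apply/polyP => i; case: (leqP i k) => hi.
  by rewrite !coef_rev_poly ?leq_subr // subKn.
by rewrite !nth_default ?(leq_trans (size_rev_poly _ _)) ?(leq_trans sQ).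
Qed.

(** Positivity makes the Hankel matrix invertible, which yields a monic [v] of degree [k] orthogonal
    to all lower degrees. Its reversal is [Q], with [Q_0 = 1], and [P] is a truncation of [T Q]. *)
Lemma pade_poly_exists T k : mom_posdef T k -> exists P Q, pade_poly T k P Q.
Proof.
move=> pd.
pose H : 'M[K]_k := \matrix_(i, j) T`_(i + j).+1.
have HE (w : 'rV_k) j : (w *m H) 0 j = mom T (rVpoly w * 'X^j).
  rewrite mxE (_ : rVpoly w = \sum_(i < k) w 0 i *: 'X^i); last first.
    rewrite {1}[w]row_sum_delta linear_sum; apply: eq_bigr => i _.
    by rewrite linearZ /= rVpoly_delta.
  rewrite mulr_suml linear_sum; apply: eq_bigr => i _.
  by rewrite mxE -scalerAl -exprD linearZ /= mom_Xn.
have uH : H \in unitmx.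
  (* A nonzero vector in the kernel would be an isotropic polynomial of degree [< k]. *)
  rewrite -row_free_unit -kermx_eq0; apply/rowV0P => w /sub_kermxP w0.
  apply/eqP; apply: contraT => wn0.
  have : 0 < mom T (rVpoly w ^+ 2).
    apply: pd; last exact: size_poly.
    by apply: contraNneq wn0 => h; rewrite -[w]rVpolyK h linear0.
  rewrite expr2 -{2}[rVpoly w]coefK poly_def mulr_sumr linear_sum big1 ?ltxx // => i _.
  rewrite -scalerAr linearZ /=.
  have hi : (i < k)%N by apply: leq_trans (ltn_ord i) (size_poly _ _).
  by rewrite -(HE w (Ordinal hi)) w0 mxE mulr0.
(* [- rVpoly w] is the orthogonal projection of [X ^ k] to the polynomials of degree [< k]. *)
pose w := (\row_j - T`_(k + j).+1) *m invmx H.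
pose v := rVpoly w + 'X^k.
have sw : (size (rVpoly w) <= k)%N by exact: size_poly.
have vk : v`_k = 1 by rewrite coefD nth_default // add0r coefXn eqxx.
have sv : (size v <= k.+1)%N.
  by rewrite (leq_trans (size_polyD _ _)) // geq_max size_polyXn leqnn andbT leqW.
pose Q := rev_poly k v; have sQ : (size Q <= k.+1)%N by exact: size_rev_poly.
have hv j : (j < k)%N -> mom T ('X^j * v) = 0.
  move=> hj; rewrite mulrDr linearD /= -exprD mom_Xn mulrC -(HE w (Ordinal hj)).
  by rewrite /w mulmxKV // mxE /= addnC addNr.
exists (take_poly k.+1 (T * Q)), Q; split=> //; first exact: size_poly.
  by rewrite coef_rev_poly // subn0 vk oner_eq0.
move=> n hn; rewrite coef_take_poly; case: ltnP => // hk.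
have -> : n = ((n - k.+1) + k).+1 by lia.
rewrite -mom_Xn_rev // /Q rev_polyK // hv //; lia.
Qed.
End PosDef.

(** * Congruences modulo powers of [X] *)

Section DvdXn.
Variable F : fieldType.
Implicit Types (T P Q p q : {poly F}) (k n : nat).

Lemma dvdXnP n p : reflect (forall i, (i < n)%N -> p`_i = 0) ('X^n %| p).
Proof.
apply: (iffP idP) => [/dvdpP[q ->] i hi|h]; first by rewrite coefMXn hi.
rewrite -(poly_take_drop n p) dvdp_addl ?dvdp_mull // (_ : take_poly n p = 0) ?dvdp0 //.
by apply/polyP => i; rewrite coef_take_poly coef0; case: ltnP => // /h.
Qed.

Lemma eqXnP n p q : reflect (forall i, (i < n)%N -> p`_i = q`_i) ('X^n %| p - q).
Proof.
apply: (iffP (dvdXnP _ _)) => h i /h; first by rewrite coefB => /subr0_eq.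
by rewrite coefB => ->; rewrite subrr.
Qed.

Lemma dvdXn_cancel n p q : q`_0 != 0 -> 'X^n %| p * q -> 'X^n %| p.
Proof.
move=> q0; rewrite Gauss_dvdpl // coprimep_expl // coprimep_sym.
by rewrite coprimepX /root horner_coef0.
Qed.

End DvdXn.

(** * Coprimality and exact degree of Pade pairs *)

Section Exact.
Variable K : realFieldType.
Implicit Types (T P Q p u : {poly K}) (k n : nat).

Lemma pade_polyP T k P Q : pade_poly T k P Q <->
  [/\ (size P <= k.+1)%N, (size Q <= k.+1)%N, Q`_0 != 0
    & 'X^((2 * k).+1) %| T * Q - P].
Proof.
by split=> -[? ? ? h]; split=> //; [apply/eqXnP => i /h | move=> n hn; exact: (eqXnP _ _ _ h)].
Qed.

(** Removing a nonconstant common factor would leave a pair of degrees below [k] that still agrees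
    with [T] to order [2 k], against [pade_poly_minimal]. The factor can be cancelled modulo powers
    of [X] since it divides [Q] and [Q_0 != 0]. *)
Lemma pade_poly_coprime T k P Q : (0 < k)%N -> mom_posdef T k ->
  pade_poly T k P Q -> coprimep P Q.
Proof.
case: k => // k _ pd /pade_polyP[sP sQ Q0 hT].
have Qn0 : Q != 0 by apply: contraNneq Q0 => ->; rewrite coef0.
set g := gcdp P Q; have gn0 : g != 0 by rewrite gcdp_eq0 negb_and Qn0 orbT.
rewrite /coprimep -/g eqn_leq [X in _ && X]size_poly_gt0 gn0 andbT leqNgt; apply/negP => sg.
have PE : P = (P %/ g) * g by rewrite divpK // dvdp_gcdl.
have QE : Q = (Q %/ g) * g by rewrite divpK // dvdp_gcdr.
have g0 : g`_0 != 0 by apply: contraNneq Q0; rewrite QE coef0M => ->; rewrite mulr0.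
have /dvdXn_cancel : 'X^((2 * k.+1).+1) %| (T * (Q %/ g) - P %/ g) * g.
  by rewrite mulrBl -mulrA -QE -PE.
move=> /(_ g0)/eqXnP h.
have : Q %/ g = 0.
  apply: (pade_poly_minimal (k := k) (P := P %/ g) pd); rewrite ?size_divp //.
  - by move: (size P) (size g) sP sg => a b; lia.
  - by move: (size Q) (size g) sQ sg => a b; lia.
by move=> h0; rewrite QE h0 mul0r eqxx in Qn0.
Qed.

Lemma pade_poly_degree T k P Q : (0 < k)%N -> mom_posdef T k ->
  pade_poly T k P Q -> maxn (size P).-1 (size Q).-1 = k.
Proof.
case: k => // k _ pd [sP sQ Q0 hT].
apply/eqP; rewrite eqn_leq; apply/andP; split; first by move: (size P) (size Q) sP sQ => a b; lia.
rewrite ltnNge; apply/negP => h.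
have Q00 : Q = 0 by apply: (pade_poly_minimal (k := k) (P := P) pd) => //; move: (size P) (size Q) h => a b; lia.
by rewrite Q00 coef0 eqxx in Q0.
Qed.

End Exact.

(** * Substitution into a Pade pair and its leading error *)

Section Reversion.
Variable F : fieldType.
Implicit Types (T P Q H : {poly F}) (k m n : nat).

Lemma dvdX_coef0 H : H`_0 = 0 -> 'X %| H.
Proof. by move=> h; rewrite -['X]expr1; apply/dvdXnP => -[|]. Qed.

(** First-order Taylor expansion of [P(H)] around [X]; the derivative of [P] may be replaced by its
    constant term because [H - X] is already divisible by [X ^ m]. *)
Lemma comp_poly_first_order m P H : 'X %| H -> 'X^m %| H - 'X ->
  'X^(m.+1) %| P \Po H - P - (P`_1)%:P * (H - 'X).
Proof.
move=> XH XmH; elim/poly_ind: P => [|p c IH].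
  by rewrite comp_poly0 coef0 subrr mul0r subrr dvdp0.
have mul_dvd (a b : {poly F}) : 'X^m %| a -> 'X %| b -> 'X^(m.+1) %| a * b.
  by move=> ha hb; rewrite exprSr dvdp_mul.
have -> : (p * 'X + c%:P)`_1 = p`_0 by rewrite coefD coefMX coefC addr0.
rewrite comp_poly_MXaddC.
have -> : (p \Po H) * H + c%:P - (p * 'X + c%:P) - (p`_0)%:P * (H - 'X) =
  (p \Po H - p) * H + (H - 'X) * (p - (p`_0)%:P) by ring.
apply: dvdp_add; apply: mul_dvd => //; last first.
  by apply: dvdX_coef0; rewrite coefB coefC subrr.
rewrite -[p \Po H - p](subrK ((p`_1)%:P * (H - 'X))) dvdp_add //; last exact: dvdp_mull.
by apply: dvdp_trans IH; rewrite dvdp_exp2l.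
Qed.

(* If [P / Q] agrees with [T] to order [2 k] and [P(H) / Q(H)] with [T] to
   order [2 k + 1], then [H = X + c X ^ (2 k + 1) + ...] with the leading
   error [c] determined by that of [P / Q]. *)
Lemma pade_reversion T k P Q H : (0 < k)%N -> pade_poly T k P Q -> T`_1 != 0 ->
  H`_0 = 0 -> 'X^((2 * k).+2) %| P \Po H - T * (Q \Po H) ->
  Q`_0 * T`_1 * H`_(2 * k).+1 = (T * Q - P)`_(2 * k).+1.
Proof.
move=> k0 [_ _ Q0 hT] T1 H0 hPQ; have XH := dvdX_coef0 H0.
have P1 : P`_1 - T`_0 * Q`_1 = Q`_0 * T`_1.
  by rewrite -hT ?coefM ?big_ord_recl ?big_ord0 /=; [ring|lia].
(* Expanding [P(H) - T Q(H)] to first order in [H - X] gains one order of precision; the linear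
   coefficient is [P_1 - T_0 Q_1 = Q_0 T_1], which is nonzero. *)
have key m : (m <= (2 * k).+1)%N -> 'X^m %| H - 'X ->
    'X^(m.+1) %| P - T * Q + (Q`_0 * T`_1)%:P * (H - 'X).
  move=> hm hX; have := comp_poly_first_order P XH hX.
  have /(dvdp_mull T) := comp_poly_first_order Q XH hX.
  have : 'X^(m.+1) %| P \Po H - T * (Q \Po H).
    by apply: dvdp_trans hPQ; rewrite dvdp_exp2l // ltnS.
  have : 'X^(m.+1) %| (H - 'X) * ((T - (T`_0)%:P) * (Q`_1)%:P).
    rewrite exprSr dvdp_mul // dvdp_mulr //.
    by apply: dvdX_coef0; rewrite coefB coefC subrr.
  move=> h1 h2 h3 h4.
  rewrite -P1 (_ : _ + _ = (P \Po H - T * (Q \Po H)) +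
    T * (Q \Po H - Q - (Q`_1)%:P * (H - 'X)) - (P \Po H - P - (P`_1)%:P * (H - 'X))
    + (H - 'X) * ((T - (T`_0)%:P) * (Q`_1)%:P)); last by rewrite polyCB polyCM; ring.
  by rewrite dvdp_add // dvdp_sub // dvdp_add.
(* The error [P - T Q] vanishes up to order [2 k], so until then [key] improves the congruence of
   [H] and [X] by one order at each step. *)
have hX m : (m <= (2 * k).+1)%N -> 'X^m %| H - 'X.
  elim: m => [|m IH] hm; first by rewrite expr0 dvd1p.
  have := key m (ltnW hm) (IH (ltnW hm)); rewrite dvdp_addr; last first.
    by apply/eqXnP => i hi; rewrite hT // -ltnS (leq_trans hi).
  by rewrite mul_polyC dvdpZr // mulf_neq0.
have /dvdXnP/(_ (2 * k).+1 (ltnSn _)) := key _ (leqnn _) (hX _ (leqnn _)).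
rewrite coefD coefCM !coefB coefX (_ : (2 * k).+1 == 1%N = false); last by lia.
rewrite subr0 => /eqP; rewrite addrC addr_eq0 => /eqP ->; ring.
Qed.

End Reversion.

(** * Divided differences and the Christoffel-Darboux kernel *)

Section Kernel.
Variable K : comNzRingType.
Implicit Types (T P Q p u v : {poly K}) (k n : nat) (z w : K).

(** The divided difference [(v(X) - v(z)) / (X - z)], expanded so as to make sense over a ring. *)
Definition divdiff v z : {poly K} :=
  \sum_(j < size v) v`_j *: \sum_(l < j) z ^+ l *: 'X^(j.-1 - l).

Lemma divdiffE v z : ('X - z%:P) * divdiff v z = v - v.[z]%:P.
Proof.
have vE : v = \sum_(j < size v) v`_j *: 'X^j by rewrite -poly_def coefK.
rewrite [X in _ = X - _]vE mulr_sumr horner_coef rmorph_sum /= -sumrB.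
apply: eq_bigr => j _; rewrite -scalerAr polyCM mul_polyC -scalerBr; congr (_ *: _).
rewrite rmorphXn /= subrXX; congr (_ * _); apply: eq_bigr => l _.
by rewrite -mul_polyC rmorphXn /= mulrC.
Qed.

Lemma size_divdiff v z k : (size v <= k.+1)%N -> (size (divdiff v z) <= k)%N.
Proof.
move=> sv; apply: (leq_trans (size_sum _ _ _)); apply/bigmax_leqP => j _.
apply: (leq_trans (size_scale_leq _ _)).
apply: (leq_trans (size_sum _ _ _)); apply/bigmax_leqP => l _.
apply: (leq_trans (size_scale_leq _ _)); rewrite size_polyXn.
by have := ltn_ord j; have := ltn_ord l; have : (l < j)%N := ltn_ord l; lia.
Qed.

(* The Christoffel-Darboux identity. *)
Lemma mom_divdiffM T k Q z w (v := rev_poly k Q) : (size Q <= k.+1)%N ->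
  (forall n, (k < n <= k + k)%N -> (T * Q)`_n = 0) ->
  (z - w) * mom T (divdiff v z * divdiff v w) =
  v.[z] * mom T (divdiff v w) - v.[w] * mom T (divdiff v z).
Proof.
move=> sQ h0; have sv : (size v <= k.+1)%N := size_rev_poly k Q.
rewrite -!linearZ /= -linearB /=.
have -> : (z - w) *: (divdiff v z * divdiff v w) =
   v.[z] *: divdiff v w - v.[w] *: divdiff v z + (divdiff v z - divdiff v w) * v.
  have := divdiffE v z; have := divdiffE v w.
  set Dz := divdiff v z; set Dw := divdiff v w => ew ez.
  have ez' : v.[z]%:P = v - ('X - z%:P) * Dz by rewrite ez; ring.
  have ew' : v.[w]%:P = v - ('X - w%:P) * Dw by rewrite ew; ring.
  by rewrite -!mul_polyC ez' ew' polyCB; ring.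
rewrite linearD /= [X in _ + X](mom_rev_eq0 (m := k)) ?addr0 //.
by rewrite (leq_trans (size_polyD _ _)) // geq_max size_polyN !size_divdiff.
Qed.

(** The moment of the divided difference is the polynomial of the second kind attached to [v];
    adding [T_0 v(z)] supplies the coefficient that [mom] skips. For a Pade pair the right-hand side
    is the reversed numerator. *)
Lemma mom_divdiff T k Q z (v := rev_poly k Q) :
  mom T (divdiff v z) + T`_0 * v.[z] = (rev_poly k (T * Q)).[z].
Proof.
have -> : mom T (divdiff v z) + T`_0 * v.[z] =
    \sum_(j < size v) v`_j * \sum_(l < k.+1) z ^+ l * ('X^l * T)`_j.
  rewrite /divdiff linear_sum horner_coef mulr_sumr -big_split /=.
  apply: eq_bigr => j _; rewrite linearZ /= mulrCA -mulrDr; congr (_ * _).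
  have hj : (j < k.+1)%N := leq_trans (ltn_ord j) (size_rev_poly k Q).
  have -> : \sum_(l < k.+1) z ^+ l * ('X^l * T)`_j = \sum_(l < j.+1) z ^+ l * T`_(j - l).
    rewrite (big_ord_widen k.+1 (fun l => z ^+ l * T`_(j - l)) hj) [RHS]big_mkcond.
    apply: eq_bigr => l _; rewrite coefXnM ltnS ltnNge.
    by case: leqP; rewrite ?mulr0.
  rewrite big_ord_recr /= subnn [T`_0 * _]mulrC; congr (_ + _).
  rewrite linear_sum; apply: eq_bigr => l _; rewrite linearZ /= mom_Xn.
  by congr (_ * T`__); have := ltn_ord l; lia.
rewrite (sum_coef_widen (fun j => \sum_(l < k.+1) z ^+ l * ('X^l * T)`_j) (size_rev_poly k Q)).
under eq_bigr do rewrite mulr_sumr.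
rewrite exchange_big horner_poly /=; apply: eq_bigr => l _.
have hl : (l <= k)%N by rewrite -ltnS.
have -> : (T * Q)`_(k - l) = ('X^l * T * Q)`_k by rewrite -mulrA coefXnM ltnNge hl.
rewrite coefM mulr_suml; apply: eq_bigr => j _.
have hj : (j <= k)%N by rewrite -ltnS.
by rewrite coef_rev_poly // mulrC [_ * z ^+ l]mulrC mulrA.
Qed.

(** The relation [z * z' = 1] stands in for [1 / z], as [K] is only a ring. *)
Lemma horner_rev k P z z' : (size P <= k.+1)%N -> z * z' = 1 ->
  (rev_poly k P).[z'] * z ^+ k = P.[z].
Proof.
move=> sP zz; rewrite horner_poly (horner_coef_wide _ sP) mulr_suml.
rewrite (reindex_inj rev_ord_inj) /=; apply: eq_bigr => i _.
have hi : (i <= k)%N by rewrite -ltnS.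
rewrite subSS subKn // -mulrA; congr (_ * _).
have -> : z ^+ k = z ^+ (k - i) * z ^+ i by rewrite -exprD subnK.
by rewrite mulrA -exprMn (mulrC z') zz expr1n mul1r.
Qed.

End Kernel.

(** * Change of coefficients *)

Section MapMoment.
Variables (K L : comNzRingType) (phi : {rmorphism K -> L}).
Implicit Types (T P Q v : {poly K}).

Lemma mom_map (g : {poly K}) T : injective phi ->
  mom (map_poly phi T) (map_poly phi g) = phi (mom T g).
Proof.
move=> phi_inj; have sg : (size (map_poly phi g) <= size g)%N by rewrite size_poly.
rewrite (mom_widen _ sg) rmorph_sum.
by apply: eq_bigr => i _; rewrite !coef_map rmorphM.
Qed.

Lemma rev_poly_map k Q : rev_poly k (map_poly phi Q) = map_poly phi (rev_poly k Q).
Proof.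
apply/polyP => i; rewrite [RHS]coef_map; case: (leqP i k) => hi.
  by rewrite !coef_rev_poly ?coef_map.
by rewrite !nth_default ?raddf0 ?(leq_trans (size_rev_poly _ _) hi).
Qed.

End MapMoment.

(** * Positive definiteness against positivity in the upper half-plane *)

Section ComplexPos.
Variable R : rcfType.
Implicit Types (T P Q v : {poly R}) (z w : R[i]).
Local Notation toC := (real_complex R).
Local Notation "p ^C" := (map_poly toC p) : ring_scope.

Lemma map_conjc_real v : map_poly conjc v^C = v^C.
Proof. by apply/polyP => i; rewrite coef_map /= coef_map; exact: conjc_real. Qed.

Lemma horner_conjc v z : v^C.[conjc z] = conjc v^C.[z].
Proof. by rewrite -horner_map /= map_conjc_real. Qed.

Lemma divdiff_conjc v z : divdiff v^C (conjc z) = map_poly conjc (divdiff v^C z).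
Proof.
rewrite /divdiff rmorph_sum; apply: eq_bigr => j _ /=.
rewrite map_polyZ -coef_map map_conjc_real rmorph_sum; congr (_ *: _).
by apply: eq_bigr => l _; rewrite /= map_polyZ rmorphXn /= map_polyXn.
Qed.

(** Writing [D = U + i V] with [U] and [V] real gives [D conj(D) = U ^ 2 + V ^ 2], so the Hermitian
    extension of the form is nonnegative. *)
Lemma mom_mul_conjc T (D : {poly R[i]}) k : mom_posdef T k -> (size D <= k)%N ->
  exists2 r : R, 0 <= r & mom T^C (D * map_poly conjc D) = toC r.
Proof.
move=> pd sD.
pose U := \poly_(i < k) complex.Re D`_i; pose V := \poly_(i < k) complex.Im D`_i.
have DE : D = U^C + ('i%C)%:P * V^C.
  apply/polyP => i; rewrite coefD coefCM !coef_map /= !coef_poly.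
  case: ltnP => hi; first by rewrite -complexE.
  by rewrite nth_default ?(leq_trans sD) //= !rmorph0 mulr0 addr0.
have DE' : map_poly conjc D = U^C - ('i%C)%:P * V^C.
  rewrite DE rmorphD rmorphM /= !map_conjc_real map_polyC /=.
  by rewrite (_ : 0 -i* 1 = - 'i)%C ?polyCN ?mulNr //; apply/eqP; rewrite eq_complex /= oppr0 !eqxx.
have msq_ge0 (W : {poly R}) : (size W <= k)%N -> 0 <= mom T (W ^+ 2).
  by move=> sW; have [->|W0] := eqVneq W 0; [rewrite expr0n linear0 | apply/ltW/pd].
exists (mom T (U ^+ 2) + mom T (V ^+ 2)); first by rewrite addr_ge0 ?msq_ge0 ?size_poly.
rewrite -linearD /= -mom_map; last exact: complexI.
congr (mom _ _); rewrite DE' [in D in D * _]DE rmorphD !rmorphXn /=.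
have -> : (U^C + ('i%C)%:P * V^C) * (U^C - ('i%C)%:P * V^C)
   = U^C ^+ 2 - ('i%C * 'i%C)%:P * V^C ^+ 2 by rewrite polyCM; ring.
by rewrite -expr2 sqr_i polyCN polyC1 mulN1r opprK.
Qed.

Lemma subcJ_im (w : R[i]) : w - conjc w = 'i%C * toC (2 * complex.Im w).
Proof. by rewrite subcJ rmorphM /= rmorph_nat mulrC. Qed.

(** Christoffel-Darboux at [z] and [conj z]: the left side is [2 i Im z] times a nonnegative number,
    the right side is [2 i] times the imaginary part in question, the terms in [T_0] cancelling. *)
Lemma im_rev_ge0 T k P Q z : pade_poly T k P Q -> mom_posdef T k -> 0 <= complex.Im z ->
  0 <= complex.Im ((rev_poly k Q)^C.[z] * conjc (rev_poly k P)^C.[z]).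
Proof.
move=> hp pd hz; have h0 := pade_poly_coef0 hp; case: hp => sP sQ _ hT.
have injC : injective toC := @complexI R.
have sQC : (size Q^C <= k.+1)%N by rewrite size_map_inj_poly.
have h0C n : (k < n <= k + k)%N -> (T^C * Q^C)`_n = 0.
  by move=> hn; rewrite -rmorphM coef_map h0.
have := mom_divdiffM z (conjc z) sQC h0C.
have revE w : mom T^C (divdiff (rev_poly k Q^C) w) =
    (rev_poly k P)^C.[w] - T^C`_0 * (rev_poly k Q)^C.[w].
  rewrite -rev_poly_map -[X in _ - _ * X.[_]]rev_poly_map.
  rewrite (_ : rev_poly k P^C = rev_poly k (T^C * Q^C)) ?(=^~ mom_divdiff) ?addrK //.
  apply/polyP => i; rewrite [LHS]coef_poly [RHS]coef_poly; case: ltnP => // hi.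
  rewrite -rmorphM !coef_map hT //.
  by rewrite (leq_trans (leq_subr i k)) // mul2n -addnn leq_addr.
rewrite !revE rev_poly_map divdiff_conjc.
set v := rev_poly k Q; set p := rev_poly k P.
have [|r r0 ->] := @mom_mul_conjc T (divdiff v^C z) k pd.
  by apply: size_divdiff; rewrite size_map_inj_poly ?size_rev_poly.
rewrite !horner_conjc subcJ_im; set a := v^C.[z]; set b := p^C.[z].
have -> : a * (conjc b - T^C`_0 * conjc a) - conjc a * (b - T^C`_0 * a)
   = a * conjc b - conjc (a * conjc b) by rewrite rmorphM /= conjcK; ring.
rewrite subcJ_im -mulrA -rmorphM => /(mulfI (_ : 'i%C != 0)) h.
have /complexI : toC (2 * complex.Im z * r) = toC (2 * complex.Im (a * conjc b)).
  by apply: h; rewrite eq_complex /= oner_eq0 andbF.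
have h2 : 0 <= complex.Im z * r by rewrite mulr_ge0.
by rewrite -mulrA => /mulfI <- //; rewrite pnatr_eq0.
Qed.

Lemma im_pade_ge0 T k P Q z : pade_poly T k P Q -> mom_posdef T k -> 0 < complex.Im z ->
  0 <= complex.Im (P^C.[z] * conjc Q^C.[z]).
Proof.
move=> hp pd hz; have [sP sQ _ _] := hp.
have zn0 : z != 0 by apply: contraTneq hz => ->; rewrite ltxx.
(* Inversion leads to the lower half-plane and conjugation back to the upper one; the powers of [z]
   contribute only the factor [|z| ^ (2 k)]. *)
pose w := conjc z^-1.
have hw : 0 <= complex.Im w.
  rewrite /w; case: (z) hz => a b /= hb.
  by rewrite opprK divr_ge0 // ?(ltW hb) // addr_ge0 ?sqr_ge0.
have sC (p : {poly R}) : (size p <= k.+1)%N -> (size p^C <= k.+1)%N.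
  by move=> sp; rewrite size_map_inj_poly //; exact: complexI.
have revE (p : {poly R}) : (size p <= k.+1)%N -> p^C.[z] = conjc (rev_poly k p)^C.[w] * z ^+ k.
  move=> sp; rewrite -horner_conjc /w conjcK -rev_poly_map horner_rev ?sC //.
  by rewrite mulfV.
rewrite !revE // rmorphM rmorphXn /= conjcK.
have := im_rev_ge0 hp pd hw.
set a := _.[w]; set b := _.[w] => h.
have -> : conjc b * z ^+ k * (a * conjc z ^+ k) = (a * conjc b) * (z * conjc z) ^+ k.
  by rewrite exprMn; ring.
rewrite -sqr_normc -exprM normc_def -rmorphXn /=.
case: (a * conjc b) h => x y /= h.
by rewrite mulr0 add0r mulr_ge0 // exprn_ge0 ?sqrtr_ge0.
Qed.

Lemma im_mulr (w : R[i]) (t : R) : complex.Im (w * toC t) = complex.Im w * t.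
Proof. by case: w => a b /=; rewrite mulr0 add0r. Qed.

Lemma real_complexX (t : R) n : toC (t ^+ n) = toC t ^+ n.
Proof. exact: rmorphXn. Qed.

(** For real [t], [Im A(t)] is a real polynomial in [t], so its sign passes to the limit at 0. *)
Lemma im_horner0_ge0 (A : {poly R[i]}) (e : R) : 0 < e ->
  (forall t : R, 0 < t < e -> 0 <= complex.Im A.[toC t]) -> 0 <= complex.Im A.[0].
Proof.
move=> e0 hA; pose B := \poly_(i < size A) complex.Im A`_i.
have BE (t : R) : complex.Im A.[toC t] = B.[t].
  rewrite horner_poly horner_coef (raddf_sum (@complex.Im R : Rcomplex R -> R)).
  by apply: eq_bigr => i _; rewrite -[RHS]im_mulr real_complexX.
change (0 <= complex.Im A.[toC 0]); rewrite BE leNgt; apply/negP => B0.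
have [|d d0 hd] := @poly_cont _ 0 B (- B.[0]); first by rewrite oppr_gt0.
pose t := Num.min d e / 2.
have m0 : 0 < Num.min d e by rewrite lt_min d0.
have t0 : 0 < t by rewrite divr_gt0.
have tm : t < Num.min d e by rewrite /t; lra.
have /andP[td te] : (t < d) && (t < e) by rewrite -lt_min.
have := hd t; rewrite subr0 gtr0_norm // => /(_ td); rewrite ltr_norml => /andP[_].
have := hA t; rewrite t0 te BE => /(_ isT); lra.
Qed.

(** * Roots of [v] are real and simple when [v conj(p)] stays in the upper half-plane *)

Section Nevanlinna.
Variables v p : {poly R}.
Hypothesis vp_ge0 : forall w, 0 <= complex.Im w ->
  0 <= complex.Im (v^C.[w] * conjc p^C.[w]).
Hypothesis vp_coprime : forall w, root v^C w -> p^C.[w] != 0.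

(** Along the ray [w + k t] one has [v = G k ^ m t ^ m]; the sign survives division by [t ^ m > 0]
    and the limit [t -> 0]. The alternative on [w] and [k] keeps the start of the ray in the closed
    half-plane. *)
Lemma im_leading_ge0 (G : {poly R[i]}) m (w k : R[i]) :
  v^C = G * ('X - w%:P) ^+ m -> 0 <= complex.Im w ->
  0 < complex.Im w \/ 0 <= complex.Im k ->
  0 <= complex.Im (k ^+ m * (G.[w] * conjc p^C.[w])).
Proof.
move=> vE w0 hk.
(* For real [t] the conjugate of [p(w + k t)] is [p(conj w + conj k t)], which makes the quotient by
   [t ^ m] a polynomial in [t]. *)
pose A := (k ^+ m)%:P * ((G \Po (w%:P + k%:P * 'X)) * 
  (p^C \Po ((conjc w)%:P + (conjc k)%:P * 'X))).
have AE (t : R[i]) : A.[t] = k ^+ m * (G.[w + k * t] * p^C.[conjc w + conjc k * t]).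
  by rewrite /A !(hornerM, horner_comp, hornerD, hornerC, hornerX).
have -> : k ^+ m * (G.[w] * conjc p^C.[w]) = A.[0] by rewrite AE !mulr0 !addr0 horner_conjc.
have [e e0 he] : exists2 e : R, 0 < e & forall t, 0 < t < e -> 0 <= complex.Im (w + k * toC t).
  have ImE t : complex.Im (w + k * toC t) = complex.Im w + complex.Im k * t.
    by rewrite -im_mulr; case: (w); case: (k).
  case: hk => [hw|hk].
    have n0 : 0 < 1 + `|complex.Im k| by rewrite ltr_pwDl.
    exists (complex.Im w / (1 + `|complex.Im k|)); first by rewrite divr_gt0.
    move=> t /andP[t0]; rewrite ltr_pdivlMr // => ht; rewrite ImE.
    have : - `|complex.Im k| * t <= complex.Im k * t by rewrite ler_wpM2r ?(ltW t0) // lerNnormlW.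
    by lra.
  exists 1 => // t /andP[t0 _]; rewrite ImE addr_ge0 // mulr_ge0 //; exact: ltW.
apply: (im_horner0_ge0 e0) => t ht; have /andP[t0 _] := ht.
have := vp_ge0 (he t ht).
have -> : v^C.[w + k * toC t] * conjc p^C.[w + k * toC t] = A.[toC t] * toC (t ^+ m).
  have -> : conjc p^C.[w + k * toC t] = p^C.[conjc w + conjc k * toC t].
    by rewrite -horner_conjc -{2}(conjc_real t) -rmorphM -rmorphD.
  have -> : v^C.[w + k * toC t] = G.[w + k * toC t] * (k * toC t) ^+ m.
    by rewrite vE hornerM horner_exp hornerXsubC [w + _]addrC addrK.
  by rewrite AE exprMn real_complexX; ring.
by rewrite im_mulr pmulr_lge0 // exprn_gt0.
Qed.

Lemma im_rotate_lt0 (c : R[i]) : c != 0 -> complex.Im (- 'i%C * conjc c * c) < 0.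
Proof.
move=> c0; rewrite -mulrA [conjc c * c]mulrC -sqr_normc normc_def -real_complexX im_mulr /=.
rewrite sqr_sqrtr ?addr_ge0 ?sqr_ge0 // mulN1r oppr_lt0.
rewrite lt_neqAle addr_ge0 ?sqr_ge0 // andbT eq_sym paddr_eq0 ?sqr_ge0 // !sqrf_eq0.
by move: c0; rewrite eq_complex.
Qed.

(** Near a root of multiplicity [m], [v conj(p)] behaves like [c h ^ m] with [c != 0]. An [m]-th
    root [k] of [- i conj(c)] makes [c k ^ m = - i |c| ^ 2], so [k] cannot be an admissible
    direction; this excludes roots off the real line and [m >= 2]. *)
Lemma nevanlinna_root w : v != 0 -> root v^C w ->
  exists (t : R) (G : {poly R}), [/\ w = toC t, v = ('X - t%:P) * G & 0 < G.[t] * p.[t]].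
Proof.
move=> v0 vw.
have vC0 : v^C != 0 by rewrite map_poly_eq0.
wlog w0 : w vw / 0 <= complex.Im w.
  move=> H; case: (leP 0 (complex.Im w)) => hw; first exact: H.
  have [||t [G [wE vE hG]]] := H (conjc w).
  - by rewrite /root horner_conjc (eqP vw) conjc0.
  - by move: hw; case: (w) => a b /=; lra.
  by exists t, G; split=> //; rewrite -[w]conjcK wE conjc_real.
have [m [G]] := multiplicity_XsubC v^C w; rewrite vC0 /= => Gw vE.
pose c := G.[w] * conjc p^C.[w].
have c0 : c != 0 by rewrite mulf_neq0 // conjc_eq0 vp_coprime.
have m0 : (0 < m)%N.
  by case: (m) vE => // vE; move: vw; rewrite vE expr0 mulr1 (negPf Gw).
pose k := m.-root (- 'i%C * conjc c).
have km : k ^+ m = - 'i%C * conjc c by rewrite rootCK.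
have hk : ~ (0 < complex.Im w \/ 0 <= complex.Im k).
  move=> /(im_leading_ge0 vE w0); rewrite -/c km; apply/negP.
  by rewrite -ltNge im_rotate_lt0.
(* For [m >= 2] the root picked by [m.-root] has nonnegative imaginary part, hence would be
   admissible. *)
have m1 : m = 1%N.
  case: m m0 {vE km} @k hk => // -[//|m] _ k hk; case: hk; right.
  have := @Im_rootC_ge0 _ m.+2 (- 'i%C * conjc c) isT.
  by rewrite -/k -[_ <= complex.Im k]ler0c ImJ_sub ImE -mulrA mulrC.
have wE : w = toC (complex.Re w).
  case: (ltrP 0 (complex.Im w)) => h; first by case: hk; left.
  by apply/eqP; rewrite eq_complex /= eqxx eq_le h w0.
set t := complex.Re w in wE.
have vt : root v t.
  by move: vw; rewrite wE /root horner_map fmorph_eq0.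
have /factor_theorem[H vH] := vt.
have GE : G = H^C.
  apply: (@mulIf _ ('X - w%:P)); first by rewrite polyXsubC_eq0.
  rewrite -{1}(expr1 ('X - _)) -m1 -vE vH rmorphM /= wE.
  by rewrite rmorphB /= map_polyX map_polyC.
exists t, H; split=> //; first by rewrite mulrC.
have cE : c = toC (H.[t] * p.[t]).
  by rewrite /c GE wE -horner_conjc (conjc_real t) !horner_map -rmorphM.
(* Now [c] is real, and the direction [i] gives [Im (i c) = c >= 0]. *)
have := @im_leading_ge0 G m w 'i%C vE w0 (or_intror ler01).
rewrite -/c cE m1 expr1 mulrC ImiRe /= => h.
by rewrite lt_neqAle h andbT eq_sym; move: c0; rewrite cE fmorph_eq0.
Qed.

Lemma nevanlinna_roots : v != 0 ->
  exists s : seq R, [/\ uniq s, (size s).+1 = size v &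
    {in s, forall t, exists2 G, v = ('X - t%:P) * G & 0 < G.[t] * p.[t]}].
Proof.
move=> v0; have vC0 : v^C != 0 by rewrite map_poly_eq0.
have [rs vE] := closed_field_poly_normal v^C.
have lc0 : lead_coef v^C != 0 by rewrite lead_coef_eq0.
have rsE z : z \in rs -> root v^C z.
  by move=> hz; rewrite vE rootZ // root_prod_XsubC.
have rsC : rs = map toC (map (@complex.Re R) rs).
  rewrite -map_comp -[LHS]map_id; apply/eq_in_map => z /rsE /nevanlinna_root.
  by move=> /(_ v0)[t [G [-> _ _]]].
exists (map (@complex.Re R) rs); split.
(* A root listed twice would be a root of its own cofactor [G], against [0 < G.[t] * p.[t]]. *)
- rewrite -(map_inj_uniq (@complexI R)) -rsC; apply: count_mem_uniq => z.
  case: (boolP (z \in rs)) => hz; last exact/count_memPn.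
  have [t [G [zE vG Gp]]] := nevanlinna_root v0 (rsE _ hz).
  have Gt : G.[t] != 0 by apply: contraTneq Gp => ->; rewrite mul0r ltxx.
  rewrite (permP (perm_to_rem hz)) /= eqxx add1n; congr _.+1; apply/count_memPn.
  apply: contra Gt => hz2; apply/eqP/(@complexI R).
  rewrite -horner_map /= -zE rmorph0; apply/eqP.
  have -> : G^C = lead_coef v^C *: \prod_(x <- rem z rs) ('X - x%:P).
    apply: (@mulfI _ ('X - z%:P)); first by rewrite polyXsubC_eq0.
    rewrite -scalerAr; transitivity v^C.
      by rewrite [in RHS]vG rmorphM rmorphB /= map_polyX map_polyC zE.
    by rewrite [LHS]vE (perm_big _ (perm_to_rem hz)) big_cons.
  by rewrite -/(root _ _) rootZ // root_prod_XsubC.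
- rewrite size_map -(size_map_inj_poly (@complexI R)) // vE size_scale // size_prod_XsubC //.
- move=> t; rewrite -(mem_map (@complexI R)) -rsC => /rsE ht.
  by have [t' [G [/complexI <- ? ?]]] := nevanlinna_root v0 ht; exists G.
Qed.

End Nevanlinna.

(** In the division [u = q v + r], orthogonality kills [q v] because [q] has degree [< k]. The
    remainder is interpolated at the roots of [v], where the [divdiff v t] form the Lagrange basis
    up to scaling. *)
Lemma gauss_quadrature T k Q (v := rev_poly k Q) (s : seq R) (u : {poly R}) :
  (size Q <= k.+1)%N -> (forall n, (k < n <= k + k)%N -> (T * Q)`_n = 0) ->
  size v = k.+1 -> uniq s -> size s = k -> 
  {in s, forall t, v.[t] = 0 /\ (divdiff v t).[t] != 0} ->
  (size u <= k + k)%N ->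
  mom T u = \sum_(t <- s) u.[t] / (divdiff v t).[t] * mom T (divdiff v t).
Proof.
move=> sQ h0 sv us ss hs su; have v0 : v != 0 by rewrite -size_poly_gt0 sv.
have svk : (size v <= k.+1)%N by rewrite sv.
have rE t : t \in s -> (u %% v).[t] = u.[t].
  by move=> /hs[vt _]; rewrite [in RHS](divp_eq u v) hornerD hornerM vt mulr0 add0r.
have sr : (size (u %% v)%R <= k)%N by rewrite -ltnS -sv ltn_modp.
have -> : mom T u = mom T (u %% v).
  rewrite {1}(divp_eq u v) linearD /= (mom_rev_eq0 (m := k)) ?add0r //.
  by rewrite size_divp // sv leq_subLR.
have {1}-> : u %% v = \sum_(t <- s) ((u %% v).[t] / (divdiff v t).[t]) *: divdiff v t.
  apply/eqP; rewrite -subr_eq0; apply/eqP.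
  apply: (roots_geq_poly_eq0 (rs := s)) => //; last first.
    rewrite ss (leq_trans (size_polyD _ _)) // geq_max sr size_polyN.
    apply: (leq_trans (size_sum _ _ _)); apply/bigmax_leqP_seq => t _ _.
    by rewrite (leq_trans (size_scale_leq _ _)) // size_divdiff.
  apply/allP => t ts; rewrite /root hornerD hornerN horner_sum (bigD1_seq t) //=.
  rewrite big1_seq ?addr0 ?hornerZ ?divfK ?subrr //; first by have [] := hs t ts.
  move=> t' /andP[tt' ts']; rewrite hornerZ.
  have := congr1 (horner^~ t) (divdiffE v t').
  rewrite hornerM hornerXsubC hornerD hornerN hornerC (hs t ts).1 (hs t' ts').1 subrr.
  by move=> /eqP; rewrite mulf_eq0 subr_eq0 eq_sym (negPf tt') => /eqP->; rewrite mulr0.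
rewrite linear_sum; apply: eq_big_seq => t ts.
by rewrite linearZ /= rE.
Qed.

(** Passing to [1 / w] moves the hypothesis to the reversed pair, whence [k] simple real roots [t]
    of [v]. Quadrature makes [mom T (u ^ 2)] a sum of [u(t) ^ 2] with weights [p(t) / v'(t) > 0],
    and a nonzero [u] of degree [< k] cannot vanish at all of them. *)
Lemma im_pade_posdef T k P Q : (0 < k)%N -> pade_poly T k P Q -> coprimep P Q ->
  maxn (size P).-1 (size Q).-1 = k ->
  (forall z, 0 < complex.Im z -> 0 <= complex.Im (P^C.[z] * conjc Q^C.[z])) ->
  mom_posdef T k.
Proof.
move=> k0 hp cPQ dPQ hz; have h0 := pade_poly_coef0 hp; have [sP sQ Q0 hT] := hp.
set v := rev_poly k Q; set p := rev_poly k P.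
have sC (q : {poly R}) : (size q <= k.+1)%N -> (size q^C <= k.+1)%N.
  by move=> sp; rewrite size_map_inj_poly //; exact: complexI.
have revE (q : {poly R}) (w : R[i]) : (size q <= k.+1)%N -> w != 0 ->
    (rev_poly k q)^C.[w] = q^C.[w^-1] * w ^+ k.
  move=> sq w0; rewrite -(horner_rev (z' := w) (sC _ sq)) ?mulVf //.
  by rewrite rev_poly_map -mulrA -exprMn mulVf // expr1n mulr1.
have sv : size v = k.+1 := size_rev_poly_eq k Q0.
have v0 : v != 0 by rewrite -size_poly_gt0 sv.
have vp_ge0 (w : R[i]) : 0 <= complex.Im w ->
    0 <= complex.Im (v^C.[w] * conjc p^C.[w]).
  rewrite le_eqVlt => /predU1P[w0|w0].
    have -> : w = toC (complex.Re w) by apply/eqP; rewrite eq_complex /= eqxx -w0 eqxx.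
    by rewrite -horner_conjc conjc_real !horner_map -rmorphM.
  have wn0 : w != 0 by apply: contraTneq w0 => ->; rewrite ltxx.
  have hw : 0 < complex.Im (conjc w^-1).
    move: wn0 w0; case: (w) => a b /=; rewrite eq_complex negb_and /= => _ hb.
    by rewrite opprK divr_gt0 // ltr_wpDl ?sqr_ge0 // exprn_gt0.
  have := hz _ hw; rewrite !revE // !horner_conjc conjcK rmorphM rmorphXn /=.
  set a := _.[_]; set b := _.[_] => h.
  have -> : b * w ^+ k * (conjc a * conjc w ^+ k) = (conjc a * b) * (w * conjc w) ^+ k.
    by rewrite exprMn; ring.
  rewrite -sqr_normc -exprM normc_def -real_complexX im_mulr.
  by rewrite mulr_ge0 // exprn_ge0 ?sqrtr_ge0.
have vp_coprime w : root v^C w -> p^C.[w] != 0.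
  have [->|w0 vw] := eqVneq w 0.
    (* The values at 0 are [Q_k] and [P_k]; if both vanished, the degree of the pair would be below
       [k]. *)
    rewrite -[0]/(toC 0) /root !horner_map !fmorph_eq0 !horner_coef0 !coef_rev_poly // subn0.
    move=> /eqP Qk; apply/negP => /eqP Pk.
    have red (q : {poly R}) : (size q <= k.+1)%N -> q`_k = 0 -> (size q <= k)%N.
      move=> sq qk; apply/leq_sizeP => j; rewrite leq_eqVlt => /predU1P[<- //|].
      by move=> hj; rewrite nth_default // (leq_trans sq).
    move: dPQ (red _ sP Pk) (red _ sQ Qk) k0.
    by move: (size P) (size Q) => a b; lia.
  have cC : coprimep Q^C P^C by rewrite coprimep_map coprimep_sym.
  rewrite revE // mulf_neq0 ?expf_neq0 // (coprimep_root cC) //.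
  by move: vw; rewrite /root revE // mulf_eq0 expf_eq0 (negPf w0) andbF orbF.
have [s [us ss hs]] := nevanlinna_roots vp_ge0 vp_coprime v0.
have {}ss : size s = k by move: ss; rewrite sv => -[].
have divE t : t \in s -> [/\ v.[t] = 0, 0 < (divdiff v t).[t] * p.[t] &
   mom T (divdiff v t) = p.[t]].
  move=> /hs[G vE Gp]; have vt : v.[t] = 0 by rewrite vE hornerM hornerXsubC subrr mul0r.
  have GE : divdiff v t = G.
    apply: (@mulfI _ ('X - t%:P)); first by rewrite polyXsubC_eq0.
    by rewrite divdiffE vt subr0.
  split=> //; rewrite ?GE //; have := mom_divdiff T k Q t.
  by rewrite /= -/v vt GE mulr0 addr0 (rev_poly_pade hp).
move=> u u0 su.
have su2 : (size (u ^+ 2)%R <= k + k)%N.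
  rewrite expr2 (leq_trans (size_polyMleq _ _)) // (leq_trans (leq_pred _)) //.
  by rewrite leq_add.
rewrite (gauss_quadrature sQ h0 sv us ss _ su2); last first.
  move=> t /divE[? h _]; split=> //; apply: contraTneq h => ->.
  by rewrite mul0r ltxx.
have pos t : t \in s -> 0 < p.[t] / (divdiff v t).[t].
  move=> /divE[_ h _]; have d0 : (divdiff v t).[t] != 0.
    by apply: contraTneq h => ->; rewrite mul0r ltxx.
  have -> : p.[t] / (divdiff v t).[t] = ((divdiff v t).[t] * p.[t]) * (divdiff v t).[t]^-1 ^+ 2.
    by rewrite [_ * p.[t]]mulrC -mulrA expr2 mulVKf.
  by rewrite mulr_gt0 // exprn_even_gt0 //= invr_eq0.
have [t ts ut] : exists2 t, t \in s & u.[t] != 0.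
  apply/hasP; apply: contraT => /hasPn h; case/negP: u0; apply/eqP.
  apply: (roots_geq_poly_eq0 (rs := s)) => //; last by rewrite ss.
  by apply/allP => t /h; rewrite negbK.
have termE t' : t' \in s -> (u ^+ 2).[t'] / (divdiff v t').[t'] * mom T (divdiff v t') =
   u.[t'] ^+ 2 * (p.[t'] / (divdiff v t').[t']).
  by move=> /divE[_ _ ->]; rewrite horner_exp; ring.
rewrite (eq_big_seq _ termE) (bigD1_seq t) //= ltr_pwDl //.
  by rewrite mulr_gt0 ?pos // exprn_even_gt0.
rewrite big_seq_cond sumr_ge0 // => t' /andP[/pos/ltW ? _].
by rewrite mulr_ge0 ?sqr_ge0.
Qed.

End ComplexPos.

(** * Jets of real functions and their arithmetic *)

Notation shift_poly p x := (p \Po ('X + x%:P)).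

(** The field is general in order to serve both [R] and [R[i]]. *)
Lemma derivable_horner_num (K : numFieldType) (p : {poly K}) (z : K^o) :
  derivable (fun u : K^o => p.[u] : K^o) z 1.
Proof.
elim/poly_ind: p => [|p c IH].
  rewrite (_ : (fun u : K^o => _) = cst 0); first exact: derivable_cst.
  by apply/funext => u; rewrite horner0.
rewrite (_ : (fun u : K^o => _) = ((fun u : K^o => p.[u] : K^o) * id + cst c)).
  apply: derivableD; last exact: derivable_cst.
  by apply: derivableM => //; exact: derivable_id.
by apply/funext => u; rewrite hornerMXaddC.
Qed.

Lemma near_horner_neq0 (K : numFieldType) (p : {poly K}) (z : K^o) : p.[z] != 0 ->
  \forall u \near z, p.[u] != 0.
Proof.
move=> pz; have /derivable1_diffP/differentiable_continuous pc := @derivable_horner_num K p z.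
exact: cvgr_neq0 pc pz.
Qed.

Section Jets.
Variable R : realType.
Implicit Types (f g h : R -> R) (x y : R) (p q : {poly R}) (n : nat).

(* For [n = 0], [ndiff n.+1 f x] asks for derivability at [x] only. *)
Definition near_if n (A : R -> Prop) x : Prop :=
  if n is 0 then A x else \forall y \near x, A y.

Lemma near_if_at n (A : R -> Prop) x : near_if n A x -> A x.
Proof. by case: n => // n; exact: nbhs_singleton. Qed.

Lemma near_if_near n (A : R -> Prop) x : (\forall y \near x, A y) -> near_if n A x.
Proof. by case: n => //; exact: nbhs_singleton. Qed.

Lemma near_ifW n (A : R -> Prop) x : (forall y, A y) -> near_if n A x.
Proof. by move=> h; apply: near_if_near; near=> y; exact: h. Unshelve. all: by end_near. Qed.

Lemma near_if_imp n (A B : R -> Prop) x : (forall y, A y -> B y) ->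
  near_if n A x -> near_if n B x.
Proof. by move=> AB; case: n => [|n] /=; [exact: AB | exact: filterS]. Qed.

Lemma near_if_and n (A B : R -> Prop) x : near_if n A x -> near_if n B x ->
  near_if n (fun y => A y /\ B y) x.
Proof. by case: n => [|n] //=; exact: filterI. Qed.

Lemma near_derive1 f g x : (\forall y \near x, f y = g y) -> f^`() x = g^`() x.
Proof. by move=> h; rewrite !derive1E; exact: near_eq_derive. Qed.

Lemma near_derive1n n f g x : (\forall y \near x, f y = g y) ->
  \forall y \near x, f^`(n) y = g^`(n) y.
Proof.
elim: n => // n IH /IH /near_join; apply: filterS => y h.
by rewrite !derive1nS; exact: near_derive1.
Qed.

Lemma ndiff_congr n f g x : (\forall y \near x, f y = g y) ->
  ndiff n f x -> ndiff n g x.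
Proof.
elim: n x => [|n IH] x fg; first exact.
move=> [h1 h2]; split; last first.
  exact: near_eq_derivable (near_derive1n n fg) h2.
by apply: filterS2 (near_join fg) h1 => y; exact: IH.
Qed.

Lemma ndiffW m n f x : (m <= n)%N -> ndiff n f x -> ndiff m f x.
Proof.
move=> /subnK <-; elim: (n - m)%N => // k IH [h _].
exact/IH/(nbhs_singleton h).
Qed.

(** [ndiff] peels off the last derivative; this recursion peels off the first, so that inductions
    can pass from [f] to its derivative. *)
Lemma ndiffS n f x : ndiff n.+1 f x <->
  near_if n (fun y => derivable f y 1) x /\ ndiff n f^`() x.
Proof.
elim: n x => [|n IH] x; first by split => [[_ h]|[h _]]; split=> //; apply: filterE.
split=> [[h1 h2]|[h1 [h2 h3]]].
  split.
    by apply: filterS h1 => y /IH[/near_if_at].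
  split; last by rewrite -derive1Sn.
  by apply: filterS h1 => y /IH[].
split; last by rewrite derive1Sn.
apply: filterS2 (near_join h1) h2 => y hy1 hy2; apply/IH; split=> //.
exact: near_if_near.
Qed.

(* [p] is, up to order [n], the Taylor polynomial of [f] at [x] as a polynomial
   in [t - x]. *)
Definition jet n f x p : Prop :=
  ndiff n f x /\ forall i, (i <= n)%N -> f^`(i) x = p`_i * i`!%:R.

Lemma fact_neq0 n : n`!%:R != 0 :> R.
Proof. by rewrite pnatr_eq0 -lt0n fact_gt0. Qed.

Lemma ndiff_jet n f x : ndiff n f x ->
  jet n f x (\poly_(i < n.+1) (f^`(i)%classic x / i`!%:R)).
Proof.
by move=> h; split=> // i hi; rewrite coef_poly ltnS hi divfK ?fact_neq0.
Qed.

Lemma jet_unique n f x p q : jet n f x p -> jet n f x q ->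
  forall i, (i < n.+1)%N -> p`_i = q`_i.
Proof.
move=> [_ hp] [_ hq] i hi; apply: (mulIf (fact_neq0 i)).
by rewrite -hp // hq.
Qed.

Lemma jetW m n f x p : (m <= n)%N -> jet n f x p -> jet m f x p.
Proof.
move=> mn [h1 h2]; split; first exact: ndiffW h1.
by move=> i hi; apply: h2; apply: leq_trans hi mn.
Qed.

Lemma jet0 f x p : jet 0 f x p <-> f x = p`_0.
Proof.
split=> [[_ /(_ 0 (leqnn _))]|h]; first by rewrite derive1n0 fact0 mulr1.
by split=> // -[|//] _; rewrite derive1n0 fact0 mulr1.
Qed.

Lemma jet_at n f x p : jet n f x p -> f x = p`_0.
Proof. by move=> h; apply/jet0; exact: jetW h. Qed.

Lemma jetS n f x p : jet n.+1 f x p <->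
  [/\ near_if n (fun y => derivable f y 1) x, f x = p`_0 & jet n f^`() x p^`()].
Proof.
have E i : p^`()`_i * i`!%:R = p`_i.+1 * i.+1`!%:R.
  by rewrite coef_deriv factS natrM mulrA [p`_i.+1 * _]mulr_natr.
split=> [h|[h1 h2 [h3 h4]]].
  have [/ndiffS[h1 h2] h3] := h; split; [by []|exact: jet_at h|split=> // i hi].
  by rewrite E -h3 // derive1Sn.
split; first exact/ndiffS.
move=> [_|i]; first by rewrite derive1n0 fact0 mulr1.
by rewrite ltnS => hi; rewrite derive1Sn h4 // E.
Qed.

Lemma jet_congr n f g x p : near_if n (fun y => f y = g y) x -> jet n f x p -> jet n g x p.
Proof.
case: n => [|n] /= fg; first by move/jet0 => h; apply/jet0; rewrite -fg.
move=> [h1 h2]; split; first exact: ndiff_congr h1.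
by move=> i /h2 <-; have /nbhs_singleton := near_derive1n i fg.
Qed.

Lemma jet_cst n x (c : R) : jet n (fun=> c) x c%:P.
Proof.
elim: n c => [|n IH] c; first by apply/jet0; rewrite coefC.
apply/jetS; split; [by apply: near_ifW => y; exact: derivable_cst|by rewrite coefC|].
rewrite derivC; apply: jet_congr (IH 0); apply: near_ifW => y.
by rewrite derive1_cst.
Qed.

Lemma jet_id n x : jet n id x ('X + x%:P).
Proof.
case: n => [|n]; first by apply/jet0; rewrite coefD coefX coefC add0r.
apply/jetS; split; [by apply: near_ifW => y; exact: derivable_id|by rewrite coefD coefX coefC add0r|].
rewrite derivD derivX derivC addr0; apply: jet_congr (jet_cst n x 1).
by apply: near_ifW => y; rewrite derive1_id.
Qed.

Lemma jetD n f g x p q : jet n f x p -> jet n g x q ->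
  jet n (fun y => f y + g y) x (p + q).
Proof.
elim: n f g p q => [|n IH] f g p q.
  by move=> /jet0 hf /jet0 hg; apply/jet0; rewrite hf hg coefD.
move=> /jetS[f1 f2 f3] /jetS[g1 g2 g3]; have fg := near_if_and f1 g1; apply/jetS; split.
- by apply: near_if_imp fg => y [fy gy]; have h := derivableD fy gy; exact h.
- by rewrite f2 g2 coefD.
- rewrite derivD; apply: jet_congr (IH _ _ _ _ f3 g3).
  by apply: near_if_imp fg => y [fy gy]; have h := deriveD fy gy; rewrite !derive1E; exact (esym h).
Qed.

Lemma jetM n f g x p q : jet n f x p -> jet n g x q ->
  jet n (fun y => f y * g y) x (p * q).
Proof.
elim: n f g p q => [|n IH] f g p q.
  by move=> /jet0 hf /jet0 hg; apply/jet0; rewrite hf hg coef0M.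
move=> jf jg; have [f1 f2 f3] := (jetS _ _ _ _).1 jf.
have [g1 g2 g3] := (jetS _ _ _ _).1 jg.
have fg := near_if_and f1 g1; apply/jetS; split.
- by apply: near_if_imp fg => y [fy gy]; have h := derivableM fy gy; exact h.
- by rewrite f2 g2 coef0M.
- rewrite derivM; apply: jet_congr (jetD (IH _ _ _ _ f3 (jetW (leqnSn n) jg)) (IH _ _ _ _ (jetW (leqnSn n) jf) g3)).
  apply: near_if_imp fg => y [fy gy]; have h := deriveM fy gy.
  rewrite !derive1E addrC [X in _ + X]mulrC; exact (esym h).
Qed.

Lemma jet_horner n h x H p : jet n h x H -> jet n (fun y => p.[h y]) x (p \Po H).
Proof.
move=> hH; elim/poly_ind: p => [|p c IH].
  rewrite comp_poly0 -polyC0; apply: jet_congr (jet_cst n x 0).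
  by apply: near_ifW => y; rewrite horner0.
rewrite comp_poly_MXaddC; apply: jet_congr (jetD (jetM IH hH) (jet_cst n x c)).
by apply: near_ifW => y; rewrite hornerMXaddC.
Qed.

Lemma near_if_neq0 n g x : near_if n (fun y => derivable g y 1) x -> g x != 0 ->
  near_if n (fun y => g y != 0) x.
Proof.
case: n => // n /nbhs_singleton /derivable1_diffP/differentiable_continuous gx gx0.
exact: (gx [set u | u != 0] (open_nbhs_nbhs (conj (@open_neq _ 0) gx0))).
Qed.

(** Induction through [(1 / g)' = - g' / g ^ 2]. Mere differentiability suffices, since jets of
    quotients are later found by clearing denominators. *)
Lemma ndiff_inv n g x : ndiff n g x -> g x != 0 -> ndiff n (fun y => (g y)^-1) x.
Proof.
elim: n => [|n IH] hg gx0; first exact: I.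
have [g1 g2] := (ndiffS _ _ _).1 hg.
have gn0 := near_if_and g1 (near_if_neq0 g1 gx0).
apply/ndiffS; split; first by apply: near_if_imp gn0 => y [? ?]; exact: derivableV.
have ji := ndiff_jet (IH (ndiffW (leqnSn n) hg) gx0).
have [+ _] := jetM (jet_cst n x (-1)) (jetM (jetM ji ji) (ndiff_jet g2)).
case: n {IH hg g2 ji} g1 gn0 => [_ _ _|n g1 gn0]; first exact: I.
apply: ndiff_congr.
apply: filterS gn0 => y [dg gy0].
by rewrite [RHS]derive1E deriveV // -derive1E mulN1r -mulNr expr2 invfM.
Qed.

Lemma jet_poly n p x : jet n (horner p) x (shift_poly p x).
Proof. exact: jet_horner (jet_id n x). Qed.

Lemma size_shift p x : size (shift_poly p x) = size p.
Proof. by rewrite size_comp_poly2 // size_XaddC. Qed.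

Lemma shift_coef0 p x : (shift_poly p x)`_0 = p.[x].
Proof. by rewrite -horner_coef0 horner_comp hornerD hornerX hornerC add0r. Qed.

Lemma ndiff_rm_real n (r : ratmap R) x : (rm_den r).[x] != 0 -> ndiff n (rm_real r) x.
Proof.
move=> dx; have [hd _] := jet_poly n (rm_den r) x.
by have [] := jetM (jet_poly n (rm_num r) x) (ndiff_jet (ndiff_inv hd dx)).
Qed.

Lemma jet_rm_real n (r : ratmap R) x J : (rm_den r).[x] != 0 -> jet n (rm_real r) x J ->
  'X^(n.+1) %| J * shift_poly (rm_den r) x - shift_poly (rm_num r) x.
Proof.
move=> dx hJ; apply/eqXnP; apply: jet_unique (jet_poly n (rm_num r) x).
apply: jet_congr (jetM hJ (jet_poly n (rm_den r) x)).
apply: near_if_near; apply: filterS (near_horner_neq0 dx) => y dy.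
by rewrite /rm_real divfK.
Qed.

(** Multiplying by the denominator turns equality of derivatives into a congruence modulo
    [X ^ (2 k + 1)]; conversely the denominator can be cancelled, being nonzero at [x]. *)
Lemma is_pade_polyP k f x T (r : ratmap R) : jet (2 * k) f x T ->
  is_pade k f x r <-> pade_poly T k (shift_poly (rm_num r) x) (shift_poly (rm_den r) x).
Proof.
move=> [hf hT].
have degE : (rm_degree r <= k)%N = (size (rm_num r) <= k.+1)%N && (size (rm_den r) <= k.+1)%N.
  by rewrite /rm_degree geq_max -!subn1 !leq_subLR !add1n.
split=> [[_ hd dx hr]|/pade_polyP[]].
  apply/pade_polyP; move: hd; rewrite degE => /andP[sn sd].
  split; rewrite ?size_shift ?shift_coef0 //.
  apply: jet_rm_real => //; split; first exact: ndiff_rm_real.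
  by move=> i hi; rewrite hr // hT.
rewrite !size_shift shift_coef0 => sn sd dx hP; split=> //.
  by rewrite degE sn sd.
have hJ := ndiff_jet (ndiff_rm_real (2 * k) dx); set J := \poly_(i < _) _ in hJ.
have : 'X^((2 * k).+1) %| (J - T) * shift_poly (rm_den r) x.
  rewrite (_ : _ * _ = (J * shift_poly (rm_den r) x - shift_poly (rm_num r) x) -
     (T * shift_poly (rm_den r) x - shift_poly (rm_num r) x)); last by ring.
  by apply: dvdp_sub => //; exact: jet_rm_real.
move=> /dvdXn_cancel; rewrite shift_coef0 => /(_ dx)/eqXnP JT.
by move=> j hj; rewrite (hJ.2 _ hj) JT // -hT.
Qed.

End Jets.

(** * The Schwarzian derivative as a leading error *)

Section Schwarzian.
Variable R : realType.
Implicit Types (f : R -> R) (x : R) (r : ratmap R).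

(* The numerator of the derivative of [rm_real r], up to [rm_den r ^ 2]. *)
Definition rm_wronskian r := (rm_num r)^`() * rm_den r - rm_num r * (rm_den r)^`().

Lemma is_derive_rm_real r (t : R) : (rm_den r).[t] != 0 ->
  is_derive t 1 (rm_real r) ((rm_wronskian r).[t] / (rm_den r).[t] ^+ 2).
Proof.
move=> dt.
have h := is_deriveM (is_derive_poly (rm_num r) t) (is_deriveV dt (is_derive_poly (rm_den r) t)).
apply: is_derive_eq h _.
rewrite /rm_wronskian hornerD hornerN !hornerM /GRing.scale /=; by field.
Qed.

(** The derivative of [psi] is needed on a whole neighbourhood, because [psi] composed with [f] is
    to be differentiated repeatedly. *)
Lemma near_local_inverse r x psi : (rm_den r).[x] != 0 -> (rm_wronskian r).[x] != 0 ->
  is_local_inverse (rm_real r) x psi ->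
  \forall w \near rm_real r x,
    [/\ (rm_den r).[psi w] != 0, (rm_wronskian r).[psi w] != 0, rm_real r (psi w) = w &
     is_derive w 1 psi ((rm_den r).[psi w] ^+ 2 / (rm_wronskian r).[psi w])].
Proof.
move=> dx wx [psiK phiK].
have nd := near_horner_neq0 dx; have nw := near_horner_neq0 wx.
have nc : {near x, continuous (rm_real r)}.
  apply: filterS nd => t dt; apply/differentiable_continuous/derivable1_diffP.
  by have [] := is_derive_rm_real dt.
have psiK2 := near_join psiK; have nc2 := near_join nc.
have psix : psi (rm_real r x) = x by exact: nbhs_singleton psiK.
have psic : {for rm_real r x, continuous psi}.
  exact: nbhs_singleton (near_can_continuous psiK nc).
(* The inverse rule is applied at points [t] near [x]; continuity of [psi] then carries the result
   to [t = psi w]. *)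
have B : \forall t \near x, [/\ (rm_den r).[t] != 0, (rm_wronskian r).[t] != 0 &
    is_derive (rm_real r t) 1 psi ((rm_den r).[t] ^+ 2 / (rm_wronskian r).[t])].
  near=> t.
  have dt : (rm_den r).[t] != 0 by near: t.
  have wt : (rm_wronskian r).[t] != 0 by near: t.
  split=> //; rewrite -invf_div.
  apply: (is_derive_inverse _ _ (is_derive_rm_real dt)).
  - by near: t.
  - by near: t.
  - by rewrite mulf_neq0 // invr_eq0 expf_eq0.
have B' : \forall w \near rm_real r x, [/\ (rm_den r).[psi w] != 0, (rm_wronskian r).[psi w] != 0 &
    is_derive (rm_real r (psi w)) 1 psi ((rm_den r).[psi w] ^+ 2 / (rm_wronskian r).[psi w])].
  by rewrite -psix in B; exact: psic _ B.
by apply: filterS2 B' phiK => w [h1 h2 h3] h4; split=> //; rewrite -{1}h4.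
Unshelve. all: by end_near. Qed.

(** Applying [rm_real r] to [h = psi \o f] gives back [f], so the recentred jet [H] of [h] satisfies
    [P(H) = T Q(H)] to order [2 k + 1], and [pade_reversion] reads off its last coefficient. *)
Lemma schwarzianE k f x T r psi : (0 < k)%N -> jet (2 * k).+1 f x T -> f^`() x != 0 ->
  is_pade k f x r -> is_local_inverse (rm_real r) x psi ->
  (shift_poly (rm_den r) x)`_0 * T`_1 * (psi \o f)^`((2 * k).+1)%classic x =
  (T * shift_poly (rm_den r) x - shift_poly (rm_num r) x)`_(2 * k).+1 * (2 * k).+1`!%:R.
Proof.
move=> k0 jf f'x pr hpsi; set P := shift_poly (rm_num r) x; set Q := shift_poly (rm_den r) x.
have jf2 : jet (2 * k) f x T := jetW (leqnSn _) jf.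
have pp := (is_pade_polyP r jf2).1 pr.
have [_ _ dx hr] := pr.
have T1 : T`_1 != 0.
  by have := jf.2 1%N isT; rewrite derive1n1 (factS 0) fact0 mulr1 => <-.
have fx : rm_real r x = f x by have := hr 0 isT; rewrite !derive1n0.
have wx : (rm_wronskian r).[x] != 0.
  have k2 : (1 <= 2 * k)%N by lia.
  have := hr 1%N k2; rewrite !derive1n1 => hr1; move: f'x; rewrite -hr1 derive1E.
  have [_ ->] := is_derive_rm_real dx.
  by apply: contraNneq => ->; rewrite mul0r.
have fS n : (n <= (2 * k).+1)%N -> ndiff n f x by move=> hn; exact: ndiffW hn jf.1.
have fd : \forall y \near x, derivable f y 1.
  have k2 : (2 <= (2 * k).+1)%N by lia.
  by have /ndiffS[] := fS 2%N k2.
have fc : {for x, continuous f}.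
  by apply/differentiable_continuous/derivable1_diffP/(nbhs_singleton fd).
have N := near_local_inverse dx wx hpsi; rewrite fx in N.
have Nf : \forall y \near x, [/\ (rm_den r).[psi (f y)] != 0,
    (rm_wronskian r).[psi (f y)] != 0, rm_real r (psi (f y)) = f y &
    is_derive (f y) 1 psi ((rm_den r).[psi (f y)] ^+ 2 / (rm_wronskian r).[psi (f y)])] := fc _ N.
pose h := psi \o f; pose W := rm_wronskian r; pose D := rm_den r.
have hx : h x = x by rewrite /h /= -fx; case: hpsi => /nbhs_singleton.
have hd : \forall y \near x, derivable h y 1 /\
   h^`()%classic y = f^`()%classic y * ((D ^+ 2).[h y] * (W.[h y])^-1).
  apply: filterS2 fd Nf => y fy [h1 h2 h3 h4].
  have [? E] := is_derive1_comp h4 (derivableP fy).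
  by split=> //; rewrite [LHS]derive1E E derive1E mulrC horner_exp.
(* By [h' = f' D(h) ^ 2 / W(h)], [n] derivatives of [h] and of [f'] give [n + 1] derivatives of
   [h]. *)
have hn n : (n <= (2 * k).+1)%N -> ndiff n h x.
  elim: n => // n IH hn; have jh := ndiff_jet (IH (ltnW hn)).
  apply/ndiffS; split; first by apply: near_if_near; apply: filterS hd => y [].
  have Whx : W.[h x] != 0 by rewrite hx.
  have [_ f'n] := (ndiffS _ _ _).1 (fS _ hn).
  have [jW _] := jet_horner W jh.
  have [+ _] := jetM (ndiff_jet f'n)
    (jetM (jet_horner (D ^+ 2) jh) (ndiff_jet (ndiff_inv jW Whx))).
  by apply: ndiff_congr; apply: filterS hd => y [].
have := ndiff_jet (hn _ (leqnn _)); set Hp := \poly_(i < _) _ => jh.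
pose H := Hp - x%:P.
have H0 : H`_0 = 0 by rewrite coefB coefC -(jet_at jh) hx subrr.
have HpE p : p \Po Hp = (shift_poly p x) \Po H.
  by rewrite -comp_polyA comp_polyD comp_polyX comp_polyC subrK.
have hPQ : 'X^((2 * k).+2) %| P \Po H - T * (Q \Po H).
  rewrite -!HpE; apply/eqXnP; apply: jet_unique (jet_horner (rm_num r) jh) _.
  apply: jet_congr (jetM jf (jet_horner (rm_den r) jh)).
  apply: near_if_near; apply: filterS Nf => y [h1 _ h3 _].
  by rewrite -h3 /rm_real divfK.
rewrite -(pade_reversion k0 pp T1 H0 hPQ) jh.2 // coefB coefC subr0.
by rewrite -!mulrA.
Qed.

Lemma local_inverse_exists r x : (rm_den r).[x] != 0 -> 0 < (rm_wronskian r).[x] ->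
  exists psi, is_local_inverse (rm_real r) x psi.
Proof.
move=> dx wx; have nd := near_horner_neq0 dx.
have nw : \forall t \near x, 0 < (rm_wronskian r).[t].
  exact: (continuous_horner (p := rm_wronskian r) (open_nbhs_nbhs (conj (@open_gt _ 0) wx))).
have inc : \forall e \near 0^'+, {in `[x - e, x + e]%R &, {homo rm_real r : s t / s < t}}.
  move: nd nw => /at_right_in_segment nd /at_right_in_segment nw.
  apply: filterS2 nd nw => e hd hw.
  apply: gtr0_derive1_lt_cc.
  - move=> t /subset_itv_oo_cc/hd/is_derive_rm_real; by case.
  - move=> t /subset_itv_oo_cc ht; have [_ E] := is_derive_rm_real (hd _ ht).
    by rewrite derive1E E divr_gt0 ?hw // exprn_even_gt0 //= hd.
  - by apply: derivable_within_continuous => t /hd/is_derive_rm_real[].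
have [e e0 he] : exists2 e : R, 0 < e & {in `[x - e, x + e]%R &, {homo rm_real r : s t / s < t}}.
  near (0 : R)^'+ => e; exists e; first by [].
  by near: e.
(* Strict monotonicity makes the preimage unique; away from the image of the segment [psi] takes the
   default value [x]. *)
pose psi w := xget x [set t | t \in `[x - e, x + e]%R /\ rm_real r t = w].
have psiK : {in `[x - e, x + e]%R, cancel (rm_real r) psi}.
  move=> t ht; rewrite /psi; case: xgetP => [s _ [hs E]|/(_ t)[]]; last by [].
  case: (ltgtP s t) => // st.
  - by have := he _ _ hs ht st; rewrite E ltxx.
  - by have := he _ _ ht hs st; rewrite E ltxx.
have nK : {near x, cancel (rm_real r) psi}.
  have : \forall t \near x, t \in `]x - e, x + e[%R.
    by apply: near_in_itvoo; rewrite in_itv /= ltrBlDr !ltrDl e0.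
  by apply: filterS => t /subset_itv_oo_cc/psiK.
exists psi; split=> //; apply: near_continuous_can_sym => //.
apply: filterS nd => t dt; apply/differentiable_continuous/derivable1_diffP.
by have [] := is_derive_rm_real dt.
Unshelve. all: by end_near. Qed.

End Schwarzian.

(** * Rational maps in the Pick class *)

Section Pick.
Variable R : realType.
Implicit Types (r : ratmap R) (p q : {poly R}).
Local Notation "p ^C" := (map_poly (real_complex R) p) : ring_scope.

(** Off the roots of [q] the chart [w] is [p / q]; at such a root [p] is nonzero by coprimality, and
    the chart [1 / w] is [q / p] nearby. *)
Lemma rm_complex_holomorphic r z : sphere_holomorphic_at (rm_complex r) z.
Proof.
set p := (rm_num r)^C; set q := (rm_den r)^C.
have [qz|qz] := eqVneq q.[z] 0; last first.
  have nq := near_horner_neq0 qz.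
  left; split; first by apply: filterS nq => u qu; rewrite /rm_complex (negPf qu).
  have : derivable ((fun u : R[i]^o => p.[u] : R[i]^o) * (fun u : R[i]^o => (q.[u])^-1 : R[i]^o)) z 1.
    by apply: derivableM; [|apply: derivableV => //]; exact: derivable_horner_num.
  apply: near_eq_derivable; apply: filterS nq => u qu.
  by rewrite /rm_complex (negPf qu).
have pz : p.[z] != 0.
  have cC : coprimep q p by rewrite coprimep_map coprimep_sym rm_coprime.
  by apply: coprimep_root cC _; rewrite /root qz.
have np := near_horner_neq0 pz.
right; split.
  apply: filterS np => u pu; rewrite /rm_complex; case: eqP => // /eqP qu [] /eqP.
  by rewrite mulf_eq0 invr_eq0 (negPf pu) (negPf qu).
have : derivable ((fun u : R[i]^o => q.[u] : R[i]^o) * (fun u : R[i]^o => (p.[u])^-1 : R[i]^o)) z 1.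
  by apply: derivableM; [|apply: derivableV => //]; exact: derivable_horner_num.
apply: near_eq_derivable; apply: filterS np => u pu.
rewrite /rm_complex -/p -/q; case: eqVneq => qu /=.
  by rewrite fctE /= qu mul0r.
by rewrite mulf_eq0 invr_eq0 (negPf pu) (negPf qu) /= invf_div.
Qed.

Lemma im_div_ge0 (a b : R[i]) : b != 0 ->
  (0 <= complex.Im (a / b)) = (0 <= complex.Im (a * conjc b)).
Proof.
move=> b0; have -> : a * conjc b = a / b * (b * conjc b) by rewrite mulrA divfK.
rewrite -sqr_normc normc_def -real_complexX im_mulr pmulr_lge0 // exprn_gt0 //.
by rewrite -ltcR -normc_def normr_gt0.
Qed.

(** Multiplying [p / q] by [|q| ^ 2] keeps the sign of the imaginary part; at a pole the product is
    0, while infinity belongs to the closure. *)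
Lemma pick_classP r : pick_class (rm_complex r) <->
  forall z : R[i], 0 < complex.Im z ->
    0 <= complex.Im ((rm_num r)^C.[z] * conjc (rm_den r)^C.[z]).
Proof.
split=> [h z hz|h z hz].
  have [_] := h z hz; rewrite /closed_upper_half_plane /rm_complex /=.
  by case: eqVneq => [->|q0]; [rewrite conjc0 mulr0 | rewrite im_div_ge0].
split; first exact: rm_complex_holomorphic.
rewrite /closed_upper_half_plane /rm_complex /=; case: eqVneq => // q0.
by rewrite im_div_ge0 // h.
Qed.

End Pick.

(** * Recentring, and the equivalence itself *)

Section Main.
Variable R : realType.
Implicit Types (f : R -> R) (x : R) (r : ratmap R) (p P Q T : {poly R}).

Lemma comp_shiftK p x : (p \Po ('X - x%:P)) \Po ('X + x%:P) = p.
Proof. by rewrite -comp_polyA comp_polyB comp_polyX comp_polyC addrK comp_polyXr. Qed.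

Lemma rm_degree_shift r x :
  rm_degree r = maxn (size (shift_poly (rm_num r) x)).-1 (size (shift_poly (rm_den r) x)).-1.
Proof. by rewrite !size_shift. Qed.

Lemma rm_coprime_shift r x :
  coprimep (shift_poly (rm_num r) x) (shift_poly (rm_den r) x).
Proof. exact/coprimep_comp_poly/rm_coprime. Qed.

Lemma ratmap_shift x P Q : coprimep P Q -> Q != 0 ->
  exists r, shift_poly (rm_num r) x = P /\ shift_poly (rm_den r) x = Q.
Proof.
move=> cPQ Q0.
have d0 : Q \Po ('X - x%:P) != 0.
  by apply: contraNneq Q0 => h; rewrite -(comp_shiftK Q x) h comp_poly0.
exists (RatMap d0 (coprimep_comp_poly ('X - x%:P) cPQ)).
by rewrite !comp_shiftK.
Qed.

Lemma posdef_pade k f x T : (0 < k)%N -> mom_posdef T k -> jet (2 * k) f x T ->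
  exists r, is_pade k f x r /\ rm_degree r = k.
Proof.
move=> k0 pd jf; have [P [Q pp]] := pade_poly_exists pd.
have Q0 : Q != 0 by case: pp => _ _ + _; apply: contraNneq => ->; rewrite coef0.
have [r [rP rQ]] := ratmap_shift x (pade_poly_coprime k0 pd pp) Q0.
exists r; split; first by apply/(is_pade_polyP r jf); rewrite rP rQ.
by rewrite (rm_degree_shift r x) rP rQ (pade_poly_degree k0 pd pp).
Qed.

(** The sign of [Q_0] is unknown, but [Q_0] times the leading error is the Schwarzian derivative
    times [Q_0 ^ 2 T_1 > 0], up to a factorial. *)
Lemma schwarzian_sign k f x T r psi : (0 < k)%N -> jet (2 * k).+1 f x T ->
  0 < T`_1 -> is_pade k f x r -> is_local_inverse (rm_real r) x psi -> mom_posdef T k ->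
  mom_posdef T k.+1 <-> 0 < (psi \o f)^`((2 * k).+1)%classic x.
Proof.
move=> k0 jf T1 pr hpsi pd.
have f'x : f^`() x != 0.
  by have := jf.2 1%N isT; rewrite derive1n1 (factS 0) fact0 mulr1 => ->; rewrite gt_eqF.
have pp := (is_pade_polyP r (jetW (leqnSn _) jf)).1 pr.
have [_ _ Q0 _] := pp.
rewrite (mom_posdefS pp pd); have := schwarzianE k0 jf f'x pr hpsi.
move: Q0; set q := (shift_poly (rm_den r) x)`_0; set e := (T * _ - _)`_(2 * k).+1.
set s := (psi \o f)^`((2 * k).+1)%classic x => Q0 E.
have F0 : 0 < (2 * k).+1`!%:R :> R by rewrite ltr0n fact_gt0.
have q2 : 0 < q ^+ 2 * T`_1 by rewrite mulr_gt0 // exprn_even_gt0.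
rewrite -[0 < q * e](pmulr_lgt0 _ F0) -mulrA -E !mulrA -expr2.
by rewrite (pmulr_rgt0 _ q2).
Qed.

End Main.

Theorem corollary6 (R : realType) (d : nat) (hd : (0 < d)%N) (x : R)
    (f : R -> R) (hf : ndiff (2 * d) f x) (hf' : 0 < f^`() x) :
  (forall k : nat, (1 <= k <= d.-1)%N ->
     exists s : R, is_schwarzian k f x s /\ 0 < s)
  <->
  (exists r : ratmap R,
     [/\ is_pade d f x r, rm_degree r = d & pick_class (rm_complex r)]).
Proof.
have := ndiff_jet hf; set T := \poly_(i < _) _ => jf.
have T1 : 0 < T`_1.
  have d1 : (1 <= 2 * d)%N by lia.
  by have := jf.2 1%N d1; rewrite derive1n1 (factS 0) fact0 mulr1 => <-.
split=> [hS|[r [pr dr hr]] k hk].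
  (* Each positive Schwarzian derivative raises the degree of positivity by one, starting from
     [T_1 > 0]. *)
  have pd k : (0 < k <= d)%N -> mom_posdef T k.
    elim: k => // -[_ _|k IH hk]; first exact/mom_posdef1.
    have pdk : mom_posdef T k.+1 by apply: IH; lia.
    have hk' : (1 <= k.+1 <= d.-1)%N by lia.
    have [s [[_ _ _ [r [psi [pr hpsi sE]]]] s0]] := hS _ hk'.
    have jk : jet (2 * k.+1).+1 f x T by apply: jetW jf; lia.
    by apply/(schwarzian_sign (ltn0Sn k) jk T1 pr hpsi pdk); rewrite -sE.
  have pdd : mom_posdef T d by apply: pd; rewrite hd leqnn.
  have [r [pr dr]] := posdef_pade hd pdd jf; exists r; split=> //.
  apply/pick_classP => z hz.
  have pp := (is_pade_polyP r jf).1 pr.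
  (* Recentring at 0 is a real translation, which preserves the upper half-plane. *)
  have := @im_pade_ge0 R T d _ _ (z - real_complex R x) pp pdd.
  rewrite !map_comp_poly rmorphD /= map_polyX map_polyC !horner_comp !hornerE subrK.
  by apply; move: hz; case: (z) => a b /=; rewrite oppr0 addr0.
have pp := (is_pade_polyP r jf).1 pr.
have pdd : mom_posdef T d.
  apply: (im_pade_posdef hd pp (rm_coprime_shift r x)).
    by rewrite -rm_degree_shift.
  move=> z hz; rewrite !map_comp_poly rmorphD /= map_polyX map_polyC !horner_comp !hornerE.
  move/pick_classP: hr; apply; move: hz; case: (z) => a b /=; by rewrite addr0.
have k0 : (0 < k)%N by lia.
have jk : jet (2 * k).+1 f x T by apply: jetW jf; lia.
(* Positivity restricts to lower degrees, so the approximant of order [k] exists; its derivative at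
   [x] is that of [f], which is positive, and this provides the local inverse. *)
have pdk : mom_posdef T k by apply: mom_posdefW pdd; lia.
have [rk [prk _]] := posdef_pade k0 pdk (jetW (leqnSn _) jk).
have [_ _ dx hrk] := prk.
have k2 : (1 <= 2 * k)%N by lia.
have wx : 0 < (rm_wronskian rk).[x].
  move: hf'; have := hrk 1%N k2; rewrite !derive1n1 => <-; rewrite derive1E.
  have [_ ->] := is_derive_rm_real dx.
  by rewrite pmulr_lgt0 // invr_gt0 exprn_even_gt0.
have [psi hpsi] := local_inverse_exists dx wx.
exists ((psi \o f)^`((2 * k).+1)%classic x); split; last first.
  by apply/(schwarzian_sign k0 jk T1 prk hpsi pdk); apply: mom_posdefW pdd; lia.
split=> //; first exact: jk.1; first by rewrite gt_eqF.
by exists rk, psi.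
Qed.
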